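(* Let $\Delta$ be a pure simplicial complex of dimension $m-1\ge2$ whose clique decomposition $\Delta=\Delta_1\cup\cdots\cup\Delta_r$ satisfies conditions (i) and (ii), and suppose that $G_\Delta$ is a cycle. Then $J_\Delta$ is a prime ideal.
   Context: Let $K$ be a field, $X=(x_{ij})$ an $m\times n$ matrix of indeterminates, $S=K[X]$, and $\Delta$ a pure $(m-1)$-dimensional simplicial complex on $[n]$. For $1\le a_1<\dots<a_m\le n$, $[a_1\ldots a_m]$ is the maximal minor with columns $a_1,\dots,a_m$; $J_\Delta=(\mu_F : F\in\mathcal{F}(\Delta))$ with $\mu_F=[a_1\ldots a_m]$ for a facet $F=\{a_1<\dots<a_m\}$ (primality is independent of the labeling). Clique decomposition: let $\mathcal{S}$ be the set of simplices $\Gamma$ with vertices in $[n]$, $\dim\Gamma\ge m-1$, whose $(m-1)$-skeleton is contained in $\Delta$; the maximal elements $\Gamma_1,\dots,\Gamma_r$ of $\mathcal{S}$ give the cliques $\Delta_i=\Gamma_i^{(m-1)}$, $\Delta=\Delta_1\cup\cdots\cup\Delta_r$; $V(\Delta_i)$ is the vertex set of $\Delta_i$. Conditions: (i) $|V(\Delta_i)\cap V(\Delta_j)|\le1$ for all $i<j$; (ii) $V(\Delta_i)\cap V(\Delta_j)\cap V(\Delta_k)=\emptyset$ for all $i<j<k$. $G_\Delta$ is the simple graph on vertices $v_1,\dots,v_r$ with an edge $\{v_i,v_j\}$ ($i\ne j$) iff $V(\Delta_i)\cap V(\Delta_j)\ne\emptyset$; a cycle means a cycle graph on $r\ge3$ vertices.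 *)

(* Defs.v *)
From HB Require Import structures.
From mathcomp Require Import all_boot all_order all_algebra.
Unset Printing Implicit Defensive.
Import GRing.Theory.
Local Open Scope ring_scope.

Fixpoint mpoly (K : idomainType) (N : nat) : idomainType :=
  match N with 0 => K | S N' => {poly (mpoly K N')} end.

Fixpoint mvar (K : idomainType) (N : nat) (k : nat) : mpoly K N :=
  match N return mpoly K N with
  | 0 => 0
  | S N' => if k == N' then 'X else (mvar K N' k)%:P
  end.

(* S = K[X], X = (x_ij) an m x n matrix of indeterminates; x_ij is the
   variable with index i*n + j (0-based i < m, j < n). *)
Definition Sring (K : idomainType) (m n : nat) := mpoly K (m * n).
Definition xvar (K : idomainType) (m n i j : nat) : Sring K m n :=
  mvar K (m * n) (i * n + j).

(* The maximal minor [a_1 ... a_m] for a facet F = {a_1 < ... < a_m};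
   enum F lists the elements of F in increasing order. *)
Definition minorF (K : idomainType) (m n : nat) (F : {set 'I_n}) : Sring K m n :=
  \det (\matrix_(i < m, j < m) xvar K m n i (nth 0%N (map val (enum F)) j)).

Definition in_ideal_gen (R : comNzRingType) (I : finType) (A : {set I})
    (g : I -> R) (p : R) : Prop :=
  exists c : I -> R, p = \sum_(i in A) c i * g i.

Definition prime_ideal_pred (R : comNzRingType) (P : R -> Prop) : Prop :=
  (forall a b, P a -> P b -> P (a + b)) /\ P 0 /\
  (forall a b, P b -> P (a * b)) /\
  ~ P 1 /\ (forall a b, P (a * b) -> P a \/ P b).

Definition J_Delta (K : idomainType) (m n : nat) (Fs : {set {set 'I_n}}) :
    Sring K m n -> Prop :=
  @in_ideal_gen (Sring K m n) _ Fs (minorF K m n).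

(* Pure (m-1)-dimensional simplicial complex on [n], given by its facets. *)
Definition pure_complex (m n : nat) (Fs : {set {set 'I_n}}) : Prop :=
  Fs != set0 /\ forall F, F \in Fs -> #|F| = m.

(* Membership in the set S of the clique decomposition: simplices Gamma
   with dim >= m-1 whose (m-1)-skeleton lies in Delta. *)
Definition in_S (m n : nat) (Fs : {set {set 'I_n}}) (G : {set 'I_n}) : bool :=
  (m <= #|G|)%N && [forall H : {set 'I_n}, (H \subset G) && (#|H| == m) ==> (H \in Fs)].

(* The maximal elements Gamma_1..Gamma_r of S; V(Delta_i) = Gamma_i. *)
Definition cliques (m n : nat) (Fs : {set {set 'I_n}}) : {set {set 'I_n}} :=
  [set G | in_S m n Fs G &&
     [forall H : {set 'I_n}, in_S m n Fs H && (G \subset H) ==> (H == G)]].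

Definition cond_i (m n : nat) (Fs : {set {set 'I_n}}) : Prop :=
  forall A B, A \in cliques m n Fs -> B \in cliques m n Fs -> A != B ->
    (#|A :&: B| <= 1)%N.

Definition cond_ii (m n : nat) (Fs : {set {set 'I_n}}) : Prop :=
  forall A B C, A \in cliques m n Fs -> B \in cliques m n Fs -> C \in cliques m n Fs ->
    A != B -> B != C -> A != C -> A :&: B :&: C = set0.

(* G_Delta: vertices = cliques, edge iff vertex sets intersect.
   G_Delta is a cycle (r >= 3): the cliques can be listed without repetition
   as s_0,...,s_{r-1} so that s_i, s_j (i <> j) are adjacent exactly when
   j = i+1 mod r or i = j+1 mod r. *)
Definition G_is_cycle (m n : nat) (Fs : {set {set 'I_n}}) : Prop :=
  exists s : seq {set 'I_n},
    [/\ uniq s, (3 <= size s)%N,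
        (forall G, (G \in s) = (G \in cliques m n Fs)) &
        (forall i j, (i < size s)%N -> (j < size s)%N -> i <> j ->
           (nth set0 s i :&: nth set0 s j != set0) =
           ((j == (i.+1 %% size s)%N) || (i == (j.+1 %% size s)%N)))].

(* Main.v *)
Require Import Defs.
From HB Require Import structures.
From mathcomp Require Import all_boot all_order all_fingroup all_algebra.
From mathcomp Require Import ring zify mpoly.
Set Implicit Arguments.
Unset Strict Implicit.
Unset Printing Implicit Defensive.
Import Order.TTheory GRing.Theory.
Local Open Scope ring_scope.

(** A labelling of the columns, chosen so that at every vertex shared by two
    neighbouring cliques their diagonal initial monomials use different rows, turns
    the maximal minors of all cliques into a Groebner basis: this holds for a single
    clique, and ideals whose initial monomials involve disjoint sets of variables can
    be added.  For the cycle such a labelling leaves one entry of a shared column [w]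
    unused (as m >= 3), so that entry is a nonzerodivisor modulo the ideal and can
    serve as a pivot.  Clearing the column [w] opens the cycle into a path whose two
    end cliques have only m - 1 rows.  On a path each clique has m - 1 (resp. m - 2)
    columns, the maximal minor of which is a nonzerodivisor, such that every other
    column of the clique is determined by them up to that minor; solving clique after
    clique shows that, up to nonzerodivisors, the quotient is a subring of polynomials
    in free variables.  A second labelling, the reverse one, shows that these free
    variables satisfy no relation, and hence that the quotient is a domain. *)

(** * Initial monomials of minors *)

(** A column order cannot be cyclic: if every shared column were the last one of its clique and the
    first one of the next, the order would run around the cycle. So somewhere a shared column is
    second or last but one in a clique, where its initial monomials may use two rows. With at least
    three rows these two still miss the single row used on the other side; this is one reason for
    [3 <= m]. The Groebner property of one clique is proved without S-pairs: a nonzero polynomial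
    none of whose monomials is divisible by a diagonal is nonzero at some matrix with dependent
    rows, where all maximal minors vanish. Groebner bases serve only to recognise nonzerodivisors
    and to exclude relations; primeness comes from solving for variables. The two uses ask for
    different labellings of the path: the diagonal of each determining minor must avoid the initial
    variables, whereas in one row of each block all initial variables must be among those solved
    for. *)

Section LeadingMonomials.
Variables (K : idomainType) (N : nat).
Implicit Types (p q : {mpoly K[N]}) (m : 'X_{1..N}) (z : nat -> nat -> 'I_N).

(* In the order of [mpoly] the variables with smaller index are more significant. *)
Definition column_major z (s k : nat) : Prop :=
  forall i j i' j' : nat, (i < s)%N -> (i' < s)%N -> (j < k)%N -> (j' < k)%N ->
    (j < j')%N || ((j == j') && (i < i')%N) -> (z i j < z i' j')%N.

Lemma column_major_inj z s k i j i' j' :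
  column_major z s k -> (i < s)%N -> (i' < s)%N -> (j < k)%N -> (j' < k)%N ->
  z i j = z i' j' -> i = i' /\ j = j'.
Proof.
move=> zP si si' kj kj' E.
have H (a b c d : nat) : (a < s)%N -> (c < s)%N -> (b < k)%N -> (d < k)%N ->
    z a b = z c d -> (b < d)%N || ((b == d) && (a < c)%N) = false.
  by move=> ha hc hb hd e; apply/negP=> /(zP _ _ _ _ ha hc hb hd); rewrite e ltnn.
have := H _ _ _ _ si si' kj kj' E; have := H _ _ _ _ si' si kj' kj (esym E).
case: (ltngtP j j') => //= -> .
by case: (ltngtP i i').
Qed.

Lemma mlead_monic_lt m q :
  (forall m', m' \in msupp q -> (m' < m)%O) ->
  mlead ('X_[m] + q) = m /\ ('X_[m] + q)@_m = 1.
Proof.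
move=> Hq; have q0 : q@_m = 0.
  by apply/eqP; rewrite mcoeff_eq0; apply/negP=> /Hq; rewrite ltxx.
have c1 : ('X_[m] + q)@_m = 1 by rewrite mcoeffD mcoeffX eqxx q0 addr0.
split=> //; have sm : m \in msupp ('X_[m] + q) by rewrite mcoeff_msupp c1 oner_eq0.
apply/le_anti; rewrite (msupp_le_mlead sm) andbT.
have nz : 'X_[m] + q != 0 by apply/eqP=> E; rewrite E mcoeff0 in c1; move/eqP: c1; rewrite eq_sym oner_eq0.
have := msuppD_le (mlead_supp nz); rewrite mem_cat msuppX inE.
by case/orP => [/eqP -> //|/Hq/ltW].
Qed.

Definition diag_mnm z s : 'X_{1..N} := (\sum_(i < s) U_(z i i))%MM.

Lemma diag_mnm_gt0 z s l :
  ((0 < diag_mnm z s l) = [exists i : 'I_s, z i i == l])%N.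
Proof.
rewrite /diag_mnm mnm_sumE lt0n sum_nat_eq0 negb_forall.
by apply: eq_existsb => i; rewrite implyTb mnm1E eqb0 negbK.
Qed.

(** Reading a permutation by columns, the first column where it leaves the diagonal takes an entry
    below the diagonal, since the rows above are already taken. The diagonal product contains the
    more significant diagonal entry of that column, and the two products agree on all earlier
    variables. *)
Lemma mlead_det z s :
  column_major z s s ->
  let d := \det (\matrix_(i < s, j < s) ('X_(z i j) : {mpoly K[N]})) in
  mlead d = diag_mnm z s /\ d@_(diag_mnm z s) = 1.
Proof.
move=> zP /=; rewrite /determinant (bigD1 1%g) //= odd_perm1 expr0 mul1r.
have prodE (t : 'S_s) : \prod_i (\matrix_(i < s, j < s) ('X_(z i j) : {mpoly K[N]})) i (t i)
   = 'X_[(\sum_(i < s) U_(z i (t i)))%MM].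
  rewrite (big_morph _ (@mpolyXD _ _) (@mpolyX0 _ _)).
  by apply: eq_bigr => i _; rewrite mxE.
rewrite prodE.
have -> : (\sum_(i < s) U_(z i ((1%g : 'S_s) i)) = diag_mnm z s)%MM.
  by apply: eq_bigr => i _; rewrite perm1.
apply: mlead_monic_lt => m' /msupp_sum_le /flatten_mapP [t].
rewrite mem_filter => /andP [t1 _].
rewrite prodE mulr_sign => Hm'.
have {Hm'} -> : m' = (\sum_(i < s) U_(z i (t i)))%MM.
  by apply/eqP; move: Hm'; case: odd_perm; rewrite ?(perm_mem (msuppN _)) msuppX inE.
rewrite (reindex_inj (@perm_inj _ t^-1)) /=.
under eq_bigr do rewrite permKV.
set u := (t^-1)%g.
have [j uj Hj] : exists2 j : 'I_s, u j != j & forall j' : 'I_s, (j' < j)%N -> u j' = j'.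
  have [j0 Hj0] : exists j : 'I_s, u j != j.
    apply/existsP; apply: contraR t1 => /existsPn H; apply/eqP.
    rewrite -[t]invgK -[RHS]invg1 -/u; congr (_^-1)%g; apply/permP=> j.
    by rewrite perm1; apply/eqP; have := H j; rewrite negbK.
  case: (@arg_minnP _ j0 (fun j => u j != j) (fun j => nat_of_ord j)) => // j H1 H2.
  exists j => // j' lt; apply/eqP; apply: contraTT lt => /H2.
  by rewrite -leqNgt.
have luj : (j < u j)%N.
  rewrite ltn_neqAle eq_sym -(inj_eq val_inj) in uj *; rewrite uj /= leqNgt; apply/negP=> lt.
  by move: (Hj _ lt) => /perm_inj E; rewrite E eqxx in uj.
have eqdeg (v : 'I_s -> 'I_s) : mdeg (\sum_(i < s) U_(z (v i) i))%MM = s.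
  by rewrite mdeg_sum; under eq_bigr do rewrite mdeg1; rewrite sum1_card card_ord.
have late (j' : 'I_s) : ~~ (j' < j)%N -> (z j j < z (u j') j')%N.
  rewrite -leqNgt leq_eqVlt => /orP[/eqP/val_inj <-|lt]; apply: zP => //.
    by rewrite eqxx luj orbT.
  by rewrite lt.
have late1 (j' : 'I_s) : ~~ (j' < j)%N -> (z j j <= z j' j')%N.
  rewrite -leqNgt leq_eqVlt => /orP[/eqP/val_inj <- //|lt].
  by apply/ltnW/zP => //; rewrite lt.
apply/ltmcP; first by rewrite eqdeg (eqdeg id).
exists (z j j) => [l ll|].
  rewrite /diag_mnm !mnm_sumE; apply: eq_bigr => j' _; rewrite !mnm1E.
  case: (boolP (j' < j)%N) => [/Hj -> //|H].
  rewrite -!(inj_eq val_inj) /= !gtn_eqF //.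
    exact: leq_trans ll (late1 _ H).
  exact: ltn_trans ll (late _ H).
have -> : ((\sum_(i < s) U_(z (u i) i))%MM (z j j) = 0)%N.
  rewrite mnm_sumE big1 // => j' _; rewrite mnm1E.
  case: (boolP (j' < j)%N) => [lt|/late lt]; rewrite -(inj_eq val_inj) /=.
    by rewrite Hj // ltn_eqF // zP // lt.
  by rewrite gtn_eqF.
by rewrite diag_mnm_gt0; apply/existsP; exists j.
Qed.
End LeadingMonomials.

(** * The ideal of maximal minors of one matrix *)

(** Membership in the monomial ideal generated by the diagonals of the maximal minors of the first
    [k] columns. It is a recursion on the last column because the degeneration argument below peels
    off that column and, with it, possibly the last row. *)
Fixpoint has_diag N (z : nat -> nat -> 'I_N) (m : 'X_{1..N}) (k s : nat) : bool :=
  match k, s with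
  | _, 0 => true
  | 0, _.+1 => false
  | k'.+1, s'.+1 => has_diag z m k' s'.+1 || (0 < m (z s' k'))%N && has_diag z m k' s'
  end.

Lemma fraction_embedding (R : idomainType) :
  exists (Q : fieldType) (F : {rmorphism R -> Q}), forall a, (F a == 0) = (a == 0).
Proof. by exists {fraction R}, (@tofrac R); apply: tofrac_eq0. Qed.

Lemma mmap_rmorph (K R : comNzRingType) N (g : {rmorphism {mpoly K[N]} -> R}) p :
  mmap (g \o (@mpolyC N K)) (fun i => g 'X_i) p = g p.
Proof.
rewrite [in RHS](mpolyE p) raddf_sum; apply: eq_bigr => m _.
rewrite -mul_mpolyC /= rmorphM mpolyXE_id rmorph_prod.
by congr (_ * _); apply: eq_bigr => i _; rewrite rmorphXn.
Qed.

(* The point is built by degeneration: if the variable x in row s and column k+1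
   occurs in p, the part of p of highest degree in x is normal for the matrix without
   its last row and column; a point found for it is perturbed so that the last
   coordinate of the functional is an infinitesimal and x becomes infinitely large. *)
Lemma normal_nonvanishing (K : fieldType) N (z : nat -> nat -> 'I_N) s0 k0 :
  column_major z s0 k0 -> forall k s (p : {mpoly K[N]}), (s <= s0)%N -> (k <= k0)%N ->
  p != 0 -> (forall m, m \in msupp p -> ~~ has_diag z m k s) ->
  exists (L : fieldType) (h : {rmorphism K -> L}) (v : 'I_N -> L) (f : nat -> L),
    [/\ (0 < s)%N /\ mmap h v p != 0, f s.-1 != 0,
       forall j, (j < k)%N -> \sum_(i < s) f i * v (z i j) = 0 &
       forall j, (k <= j < k0)%N -> \sum_(i < s) f i * v (z i j) != 0].
Proof.
move=> zP; elim=> [|k IH] s p ss0 kk0 p0 nd.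
  case: s ss0 nd => [_|s ss0 _]; first by move/(_ _ (mlead_supp p0)).
  have [Q [F F0]] := fraction_embedding {mpoly K[N]}.
  (* With no column to kill, the generic point works: the functional reads off the last row, whose
     entries are variables. *)
  exists Q, (F \o (@mpolyC N K)), (fun i => F 'X_i), (fun i => (i == s)%:R).
  split=> //; rewrite ?mmap_rmorph ?F0 ?eqxx ?oner_eq0 //= => j jk.
  rewrite (bigD1 ord_max) //= eqxx mul1r big1 ?addr0.
    by rewrite F0; apply/eqP=> /(congr1 (mcoeff U_(z s j))); rewrite mcoeffXU eqxx mcoeff0 => /eqP; rewrite oner_eq0.
  by move=> i; rewrite -(inj_eq val_inj) /= => /negbTE ->; rewrite mul0r.
case: s ss0 nd => [_|s ss0 nd]; first by move/(_ _ (mlead_supp p0)).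
set x := z s k.
have zI i j i' j' : (i < s.+1)%N -> (i' < s.+1)%N -> (j < k0)%N -> (j' < k0)%N -> z i j = z i' j' -> i = i' /\ j = j'.
  by move=> *; apply: (column_major_inj zP) => //; apply: leq_trans ss0.
pose J := (\max_(m <- msupp p) (m x))%N.
have leJ m : m \in msupp p -> (m x <= J)%N by move=> sm; rewrite /J (big_rem _ sm) leq_max leqnn.
have [J0|J0] := posnP J.
  have mx0 m : m \in msupp p -> m x = 0%N by move/leJ; rewrite J0 leqn0 => /eqP.
  have [m sm|L [h [v [f [[_ nz] fs Hlt Hge]]]]] := IH s.+1 p ss0 (ltnW kk0) p0.
    by have := nd _ sm; rewrite /= negb_or => /andP[].
  pose c := \sum_(i < s) f i * v (z i k).
  (* Here [x] does not occur in [p], so its value may be redefined to make the functional vanish on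
     column [k]. *)
  pose v' y := if y == x then - c / f s else v y.
  have v'E i j : (i < s.+1)%N -> (j < k0)%N -> (i != s) || (j != k) -> v' (z i j) = v (z i j).
    move=> si jk ne; rewrite /v'; case: eqP => // /zI [] // ei ej.
    by rewrite ei ej !eqxx in ne.
  exists L, h, v', f; split => //.
  - split=> //; suff -> : mmap h v' p = mmap h v p by [].
    rewrite /mmap; apply: eq_big_seq => m sm; congr (_ * _); apply: eq_bigr => y _.
    by rewrite /v'; case: eqP => // ->; rewrite mx0 // !expr0.
  - move=> j; rewrite ltnS leq_eqVlt => /orP[/eqP ->|jk]; last first.
      rewrite -[RHS](Hlt _ jk); apply: eq_bigr => i _; rewrite v'E //; last by rewrite (ltn_eqF jk) orbT.
      exact: ltn_trans jk kk0.
    rewrite big_ord_recr /= {2}/v' eqxx mulrCA divff // mulr1.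
    rewrite (eq_bigr (fun i : 'I_s => f i * v (z i k))) ?subrr // => i _.
    by rewrite v'E //= ?ltnS ?(ltnW (ltn_ord i)) // (ltn_eqF (ltn_ord i)).
  - move=> j /andP[kj jk]; rewrite (eq_bigr (fun i : 'I_s.+1 => f i * v (z i j))) => [|i _].
      by apply: Hge; rewrite (ltnW kj).
    by rewrite v'E // (gtn_eqF kj) orbT.
(* The part of degree exactly [J] in [x]. As [J > 0], its monomials are divisible by [x], so a
   diagonal of size [s] in the first [k] columns would extend by [x] to a forbidden one; the
   induction hypothesis applies without row [s]. *)
pose q : {mpoly K[N]} := \sum_(m <- msupp p | m x == J) p@_m *: 'X_[m].
have qE m : q@_m = if m x == J then p@_m else 0.
  rewrite /q raddf_sum /=; under eq_bigr do rewrite mcoeffZ mcoeffX.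
  have [sm|sm] := boolP (m \in msupp p).
    rewrite big_mkcond (bigD1_seq m) ?msupp_uniq //= big1 ?addr0.
      by case: ifP => _; rewrite ?eqxx ?mulr1.
    by move=> i /negbTE ->; rewrite mulr0 if_same.
  rewrite big_seq_cond big1; last first.
    by move=> i /andP[si _]; case: eqP => [E|]; rewrite ?mulr0 //; rewrite E (negbTE sm) in si.
  by case: ifP => // _; apply/esym/eqP; rewrite mcoeff_eq0.
have q0 : q != 0.
  have [m sm mJ] : exists2 m, m \in msupp p & m x = J.
    have : has (fun m : 'X_{1..N} => m x == J) (msupp p).
      apply: contraTT J0 => /hasPn H; rewrite -leqNgt leqn0.
      have : (J <= J.-1)%N.
        apply/bigmax_leqP_seq => m sm _; have := leJ _ sm; rewrite leq_eqVlt (negbTE (H _ sm)) /=.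
        by case: (J).
      by case: (J) => //= n; rewrite ltnn.
    by case/hasP => m sm /eqP; exists m.
  apply/eqP=> E; have := qE m; rewrite E mJ eqxx mcoeff0 => /esym/eqP.
  by rewrite mcoeff_eq0 sm.
have [m sm|L [h [v [f [[s_gt0 nz] fs Hlt Hge]]]]] := IH s q (ltnW ss0) (ltnW kk0) q0.
  move: sm; rewrite mcoeff_msupp qE; case: (m x =P J) => [mJ|]; last by rewrite eqxx.
  by rewrite -mcoeff_msupp => /nd /=; rewrite negb_or -/x mJ J0 => /andP[].
(* Nonzero by the last clause of the induction hypothesis, which is carried along for this
   purpose. *)
pose l := \sum_(i < s) f i * v (z i k).
have l0 : l != 0 by apply: Hge; rewrite leqnn.
(* Row [s] gets the infinitesimal coefficient ['X] in the new functional. Its contribution to a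
   column [j < k] is cancelled by changing the entry in row [s.-1], whose coefficient [f s.-1] is
   invertible; in column [k] the value [- l / 'X] of [x] does the same. *)
pose corr y := if [pick j : 'I_k | y == z s.-1 j] is Some j then v (z s j) / f s.-1 else 0.
pose w y : {poly L} := (v y)%:P - 'X * (corr y)%:P.
have w0 y : (w y).[0] = v y by rewrite hornerD hornerN hornerM hornerX !hornerC mul0r subr0.
have s1 : (s.-1 < s)%N by rewrite prednK.
have corr0 i j : (i < s.+1)%N -> (j < k0)%N -> (i != s.-1) || (k <= j)%N -> corr (z i j) = 0.
  move=> si jk; rewrite /corr; case: pickP => // j' /eqP /zI [] //.
  - exact: leq_trans s1 _.
  - exact: leq_trans (ltn_ord j') (ltnW kk0).
  by move=> -> ->; rewrite eqxx leqNgt ltn_ord.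
have corr1 j : (j < k)%N -> corr (z s.-1 j) = v (z s j) / f s.-1.
  move=> jk; rewrite /corr; case: pickP => [j' /eqP /zI []|/(_ (Ordinal jk))] /=; last by rewrite eqxx.
  - exact: leq_trans s1 _.
  - exact: leq_trans s1 _.
  - exact: ltn_trans jk kk0.
  - exact: leq_trans (ltn_ord j') (ltnW kk0).
  by move=> _ ->.
have [Q [F F0]] := fraction_embedding {poly L}.
have X0 : F 'X != 0 by rewrite F0 polyX_eq0.
pose v2 y := if y == x then - F l%:P / F 'X else F (w y).
pose f2 i := if i == s then F 'X else F (f i)%:P.
have v2E i j : (i < s.+1)%N -> (j < k0)%N -> (i != s) || (j != k) -> v2 (z i j) = F (w (z i j)).
  move=> si jk ne; rewrite /v2; case: eqP => // /zI [] // ei ej.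
  by rewrite ei ej !eqxx in ne.
have f2E (i : 'I_s) : f2 i = F (f i)%:P by rewrite /f2 (ltn_eqF (ltn_ord i)).
have sumE j : (j < k0)%N -> \sum_(i < s) f2 i * v2 (z i j) = F (\sum_(i < s) (f i)%:P * w (z i j)).
  move=> jk; rewrite raddf_sum; apply: eq_bigr => i _; rewrite f2E v2E ?(ltn_eqF (ltn_ord i)) //.
    by rewrite /= rmorphM.
  exact: leqW.
exists Q, (F \o (polyC \o h)), v2, f2; split.
- split=> //.
  (* [H] is the value of [p] at the new point with the denominator ['X ^+ J] cleared. At ['X = 0]
     only the terms of degree [J] in [x] survive, which gives the value of [q] up to powers of [v x]
     and [- l]. *)
  pose H := \sum_(m <- msupp p) (h p@_m)%:P * (\prod_(y | y != x) (w y) ^+ m y) * (- l)%:P ^+ (m x) * 'X ^+ (J - m x).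
  have HE : F 'X ^+ J * mmap (F \o (polyC \o h)) v2 p = F H.
    rewrite /mmap big_distrr raddf_sum; apply: eq_big_seq => m sm /=.
    rewrite /mmap1 (bigD1 x) //= {1}/v2 eqxx.
    rewrite (eq_bigr (fun y => F (w y ^+ m y))); last first.
      by move=> y /negbTE yx; rewrite /v2 yx rmorphXn.
    rewrite -rmorph_prod !rmorphM !rmorphXn /= polyCN rmorphN exprMn exprVn.
    rewrite -[in LHS](subnK (leJ _ sm)) exprD.
    have : F 'X ^+ m x != 0 by rewrite expf_neq0.
    move: (F 'X ^+ m x) (F 'X ^+ (J - m x)) (F (h _)%:P) ((- F _) ^+ _) (F (\prod_(y | _) _)) => d e a b c d0.
    by field.
  have H0 : H.[0] * v x ^+ J = (- l) ^+ J * mmap h v q.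
    have -> : mmap h v q = \sum_(m <- msupp p | m x == J) h p@_m * mmap1 v m.
      by rewrite /q (raddf_sum (mmap h v)); apply: eq_bigr => m _ /=; rewrite mmapZ mmapX.
    rewrite horner_sum mulr_suml mulr_sumr [RHS]big_mkcond.
    apply: eq_big_seq => m sm.
    rewrite !(hornerE, horner_exp, horner_prod) /=.
    have [mJ|mJ] := eqVneq (m x) J; last first.
      have : (J - m x)%N != 0%N by rewrite subn_eq0 -ltnNge ltn_neqAle mJ leJ.
      by rewrite expr0n => /negbTE ->; rewrite mulr0 mul0r.
    rewrite /mmap1 [X in _ = _ * X](bigD1 x) //= mJ subnn expr0 mulr1.
    under eq_bigr do rewrite horner_exp w0.
    move: (\prod_(i < N | i != x) v i ^+ m i) (h _) ((- l) ^+ J) (v x ^+ J) => a b c d.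
    by rewrite (mulrC c) -!mulrA; congr (_ * _); rewrite mulrCA (mulrC a).
  apply/eqP=> E; move: HE; rewrite E mulr0 => /esym/eqP; rewrite F0 => /eqP HH.
  move: H0; rewrite HH horner0 mul0r => /esym/eqP; rewrite mulf_eq0 (negbTE nz) orbF.
  by rewrite expf_eq0 oppr_eq0 (negbTE l0) andbF.
- by rewrite /= /f2 eqxx.
- move=> j; rewrite ltnS leq_eqVlt => /orP[/eqP ->|jk].
    rewrite big_ord_recr /= sumE // {1}/f2 {1}/v2 !eqxx mulrCA divff // mulr1.
    rewrite (eq_bigr (fun i : 'I_s => (f i * v (z i k))%:P)); last first.
      move=> i _; rewrite /w corr0 ?leqnn ?orbT //; last exact: leqW.
      by rewrite polyC0 mulr0 subr0 polyCM.
    by rewrite -raddf_sum subrr.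
  have jk0 := ltn_trans jk kk0.
  rewrite big_ord_recr /= sumE // v2E ?(ltn_eqF jk) ?orbT // {1}/f2 eqxx -rmorphM -rmorphD.
  rewrite [X in F X](_ : _ = 0) ?rmorph0 //.
  rewrite {2}/w corr0 ?polyC0 ?mulr0 ?subr0 //; last by rewrite gtn_eqF.
  rewrite -[s in X in X + _](prednK s_gt0) big_ord_recr /= {2}/w corr1 //.
  rewrite mulrBr [_ * ('X * _)]mulrCA -!polyCM [f _ * (_ / _)]mulrCA divff // mulr1.
  rewrite (eq_bigr (fun i : 'I_s.-1 => (f i * v (z i j))%:P)); last first.
    move=> i _; have is1 := ltn_ord i; rewrite /w corr0 ?(ltn_eqF is1) //.
      by rewrite polyC0 mulr0 subr0 polyCM.
    exact: leqW (leq_trans is1 (leq_pred s)).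
  rewrite -raddf_sum addrA subrK -polyCD -polyC0; congr _%:P.
  have := Hlt _ jk; rewrite -[s in X in X = _](prednK s_gt0) big_ord_recr //=.
- move=> j /andP[kj jk]; rewrite big_ord_recr /= sumE // v2E ?(gtn_eqF kj) ?orbT // {1}/f2 eqxx.
  rewrite -rmorphM -rmorphD F0; apply/eqP => /(congr1 (fun P => P.[0])).
  rewrite hornerD hornerM hornerX mul0r addr0 horner_sum horner0 => E.
  have /eqP : \sum_(i < s) f i * v (z i j) != 0 by apply: Hge; rewrite (ltnW kj).
  apply.
  by rewrite -[RHS]E; apply: eq_bigr => i _; rewrite hornerM hornerC w0.
Qed.

(** * Sums of ideals with disjoint initial variables *)

Inductive ideal_of (R : comNzRingType) (G : R -> Prop) : R -> Prop :=
| ideal_of0 : ideal_of G 0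
| ideal_ofD a g p : G g -> ideal_of G p -> ideal_of G (a * g + p).

Section Ideals.
Variable R : comNzRingType.
Implicit Types (G : R -> Prop) (p q a : R).

Lemma ideal_of_gen G p : G p -> ideal_of G p.
Proof. by move=> Gp; rewrite -[p]mul1r -[_ * _]addr0; apply: ideal_ofD (ideal_of0 _). Qed.

Lemma ideal_of_add G p q : ideal_of G p -> ideal_of G q -> ideal_of G (p + q).
Proof.
move=> Ip Iq; elim: Ip => [|a g r Gg _ IH]; first by rewrite add0r.
by rewrite -addrA; apply: ideal_ofD.
Qed.

Lemma ideal_of_mul G a p : ideal_of G p -> ideal_of G (a * p).
Proof.
elim=> [|b g r Gg _ IH]; first by rewrite mulr0; apply: ideal_of0.
by rewrite mulrDr mulrA; apply: ideal_ofD.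
Qed.

Lemma ideal_of_opp G p : ideal_of G p -> ideal_of G (- p).
Proof. by rewrite -mulN1r; apply: ideal_of_mul. Qed.

Lemma ideal_of_sub G p q : ideal_of G p -> ideal_of G q -> ideal_of G (p - q).
Proof. by move=> Ip Iq; apply: ideal_of_add => //; apply: ideal_of_opp. Qed.

Lemma ideal_of_sum G (I : Type) (r : seq I) (P : pred I) (F : I -> R) :
  (forall i, P i -> ideal_of G (F i)) -> ideal_of G (\sum_(i <- r | P i) F i).
Proof.
move=> H; elim/big_ind: _ => //; [exact: ideal_of0|exact: ideal_of_add].
Qed.

End Ideals.

Lemma ideal_of_morph (R R' : comNzRingType) (h : {rmorphism R -> R'}) G G' p :
  (forall g, G g -> ideal_of G' (h g)) -> ideal_of G p -> ideal_of G' (h p).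
Proof.
move=> H; elim=> [|a g r Gg _ IH]; first by rewrite rmorph0; apply: ideal_of0.
by rewrite rmorphD rmorphM; apply: ideal_of_add => //; apply/ideal_of_mul/H.
Qed.

Lemma ideal_of_mono (R : comNzRingType) (G G' : R -> Prop) p :
  (forall g, G g -> ideal_of G' g) -> ideal_of G p -> ideal_of G' p.
Proof. exact: (@ideal_of_morph _ _ idfun). Qed.

Section HasDiag.
Variables (N : nat) (z : nat -> nat -> 'I_N) (m : 'X_{1..N}).

Lemma has_diagP k s : has_diag z m k s -> exists c : nat -> nat,
  forall i, (i < s)%N -> [/\ (0 < m (z i (c i)))%N, (i <= c i)%N, (c i + s <= i + k)%N &
    forall i', (i' < i)%N -> (c i' < c i)%N].
Proof.
elim: k s => [|k IH] [|s] //=; try by exists id.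
case/orP => [/IH [c Hc]|/andP[m0 /IH [c Hc]]].
  by exists c => i /Hc [H1 H2 H3 H4]; split=> //; lia.
have lt i : (i < s)%N -> (c i < k)%N by move=> /[dup] H /Hc [_ _ H3 _]; lia.
exists (fun i => if (i < s)%N then c i else k) => i; rewrite ltnS leq_eqVlt => /orP[/eqP ->|si].
  rewrite ltnn; split=> //; last by move=> i' si'; rewrite si' lt.
    case: (s) lt Hc => // n lt Hc; have [_ ? _ _] := Hc n (leqnn _).
    by have := lt n (leqnn _); lia.
  lia.
have [H1 H2 H3 H4] := Hc _ si; rewrite si; split=> //; first lia.
by move=> i' i'i; rewrite (ltn_trans i'i si) H4.
Qed.

Lemma has_diagW k s (c : nat -> nat) :
  (forall i, (i < s)%N -> [/\ (0 < m (z i (c i)))%N, (c i < k)%N &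
    forall i', (i' < i)%N -> (c i' < c i)%N]) -> has_diag z m k s.
Proof.
elim: k s => [|k IH] [|s] //= Hc; first by case: (Hc 0%N).
have [H1 H2 H3] := Hc _ (leqnn _).
move: H2; rewrite ltnS leq_eqVlt => /orP[/eqP E|lt].
  rewrite E in H1; rewrite H1 /= (IH s) ?orbT // => i si; have [H4 H5 H6] := Hc i (leqW si).
  by split=> //; rewrite -E H3.
rewrite IH // => i si; have [H4 H5 H6] := Hc i si; split=> //.
by move: si; rewrite ltnS leq_eqVlt => /orP[/eqP -> //|/H3 /ltn_trans]; apply.
Qed.

End HasDiag.

(** An entry in row [i] of a diagonal has at least [i] columns before it and [s - 1 - i] behind it.
    Hence the first column can only contribute row 0 and the last one only row [s - 1], which is
    what the labellings exploit. *)
Definition diag_support N (z : nat -> nat -> 'I_N) (s k : nat) : pred 'I_N :=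
  fun y => [exists i : 'I_s, exists j : 'I_k, [&& (i <= j)%N, (j + s <= i + k)%N & y == z i j]].

Definition depends_on N (D : 'X_{1..N} -> Prop) (A : pred 'I_N) : Prop :=
  forall m m' : 'X_{1..N}, (forall y, A y -> m y = m' y) -> D m -> D m'.

Lemma has_diag_depends N (z : nat -> nat -> 'I_N) s k :
  depends_on (fun m => has_diag z m k s) (diag_support z s k).
Proof.
move=> m m' E /has_diagP [c Hc]; apply: (@has_diagW _ _ _ _ _ c) => i si.
have [H1 H2 H3 H4] := Hc i si; have ck : (c i < k)%N by lia.
split=> //; rewrite -E //; apply/existsP; exists (Ordinal si); apply/existsP; exists (Ordinal ck).
by rewrite /= H2 H3 eqxx.
Qed.

Section Groebner.
Variables (K : fieldType) (N : nat).
Implicit Types (p q f g : {mpoly K[N]}) (m : 'X_{1..N}).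
Implicit Types (G : {mpoly K[N]} -> Prop) (D : 'X_{1..N} -> Prop) (A : pred 'I_N).

(* [D] is the set of monomials of the initial ideal of the ideal generated by [G]. *)
Definition initial_by G D : Prop :=
  (forall p, ideal_of G p -> p != 0 -> D (mlead p)) /\
  (forall m, D m -> exists g, [/\ ideal_of G g, mlead g = m & g@_m = 1]).

Lemma mlead_lt_of_coef0 p m : (mlead p <= m)%O -> p@_m = 0 -> p != 0 -> (mlead p < m)%O.
Proof.
move=> le c0 p0; rewrite lt_neqAle le andbT; apply/eqP=> E.
by move: p0; rewrite -mleadc_eq0 E c0 eqxx.
Qed.

Definition mrestrict m A : 'X_{1..N} := [multinom (if A y then m y else 0%N) | y < N].

(* If the leading terms of f in I1 and g in I2 cancel, their common monomial is a
   multiple of the product of initial monomials of some g1 in I1 and g2 in I2;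
   moving a multiple of g1 * g2 from f to g lowers both leading monomials. *)
Lemma initial_by_sum G1 G2 D1 D2 A1 A2 :
  initial_by G1 D1 -> initial_by G2 D2 -> depends_on D1 A1 -> depends_on D2 A2 ->
  (forall y, A1 y -> A2 y -> False) ->
  initial_by (fun g => G1 g \/ G2 g) (fun m => D1 m \/ D2 m).
Proof.
move=> [I1 J1] [I2 J2] dep1 dep2 dis; split; last first.
  move=> m [/J1|/J2] [g [Ig gm c]]; exists g; split=> //;
  by apply: ideal_of_mono Ig => ? ?; apply: ideal_of_gen; auto.
have sumP p : ideal_of (fun g => G1 g \/ G2 g) p ->
    exists f g, [/\ ideal_of G1 f, ideal_of G2 g & p = f + g].
  elim=> [|a g r Gg _ [f1 [f2 [H1 H2 ->]]]].
    by exists 0, 0; split; rewrite ?addr0 //; exact: ideal_of0.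
  case: Gg => Gg; [exists (a * g + f1), f2|exists f1, (a * g + f2)]; split=> //.
  - exact: ideal_ofD.
  - by rewrite addrA.
  - exact: ideal_ofD.
  - by rewrite addrCA.
move=> p /sumP [f [g [If Ig ->]]] {p}.
(* Well-founded induction on a common bound of both leading monomials, because a cancellation step
   changes both summands at once. *)
suff: forall M, (mlead f <= M)%O -> (mlead g <= M)%O -> f + g != 0 -> D1 (mlead (f + g)) \/ D2 (mlead (f + g)).
  by move/(_ _ (leUl _ _) (leUr _ _)).
move=> M; elim/(well_founded_induction (@ltom_wf N)): M f g If Ig => M IH f g If Ig fM gM.
have [->|f0] := eqVneq f 0; first by rewrite add0r => g0; right; apply: I2.
have [->|g0] := eqVneq g 0; first by rewrite addr0 => _; left; apply: I1.
have [E|ne] := eqVneq (mlead f) (mlead g); last first.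
  by move=> _; rewrite mleadD //; case: (leP (mlead f) (mlead g)) => _; [right; apply: I2|left; apply: I1].
have D1f := I1 _ If f0; have D2f := I2 _ Ig g0; rewrite -E in D2f.
set m := mlead f in D1f D2f *; move=> fg0.
have fgm : (mlead (f + g) <= m)%O by apply: le_trans (mleadD_le _ _) _; rewrite -E -/m joinxx.
have [c0|c0] := eqVneq ((f + g)@_m) 0; last first.
  suff -> : mlead (f + g) = m by left.
  by apply/le_anti; rewrite fgm msupp_le_mlead // mcoeff_msupp.
(* Restricting to [A1] keeps the monomial in [D1], and likewise for [A2]. The two restrictions have
   disjoint supports, so their product still divides [m]. *)
pose m1 := mrestrict m A1; pose m2 := mrestrict m A2.
have [g1 [Ig1 mg1 c1]] : exists g, [/\ ideal_of G1 g, mlead g = m1 & g@_m1 = 1].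
  by apply: J1; apply: dep1 D1f => y Ay; rewrite mnmE Ay.
have [g2 [Ig2 mg2 c2]] : exists g, [/\ ideal_of G2 g, mlead g = m2 & g@_m2 = 1].
  by apply: J2; apply: dep2 D2f => y Ay; rewrite mnmE Ay.
pose m3 := (m - (m1 + m2))%MM.
have mE : m = (m3 + (m1 + m2))%MM.
  apply/mnmP=> y; rewrite mnmDE mnmBE mnmDE !mnmE.
  case A1y: (A1 y); case A2y: (A2 y); rewrite ?addn0 ?add0n ?subnK ?subn0 ?addn0 //.
  by case: (dis y).
pose u := 'X_[m3] * (g1 * g2).
have nz1 : g1 != 0 by apply/eqP=> H; move: c1; rewrite H mcoeff0 => /esym/eqP; rewrite oner_eq0.
have nz2 : g2 != 0 by apply/eqP=> H; move: c2; rewrite H mcoeff0 => /esym/eqP; rewrite oner_eq0.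
have mX : mlead ('X_[m3] : {mpoly K[N]}) = m3 by rewrite mleadXm.
have cX : ('X_[m3] : {mpoly K[N]})@_m3 = 1 by rewrite mcoeffX eqxx.
have g12 : mlead (g1 * g2) = (m1 + m2)%MM by rewrite mleadM // mg1 mg2.
have g12c : (g1 * g2)@_(m1 + m2) = 1 by rewrite -{1}mg1 -{1}mg2 mleadcM mg1 mg2 c1 c2 mulr1.
have um : mlead u = m.
  rewrite mleadM ?mX ?g12 -?mE ?mulf_neq0 //.
  by apply/eqP=> H; move: cX; rewrite H mcoeff0 => /esym/eqP; rewrite oner_eq0.
have uc : u@_m = 1 by rewrite mE -{1}mX -g12 mleadcM mX g12 cX g12c mulr1.
have Iu1 : ideal_of G1 u by rewrite /u [g1 * _]mulrC mulrA; apply: ideal_of_mul.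
have Iu2 : ideal_of G2 u by rewrite /u mulrA; apply: ideal_of_mul.
pose c := f@_m.
have fgE : f + g = (f - c *: u) + (g + c *: u) by rewrite addrACA [- _ + _]addrC subrr addr0.
have cu m' : (c *: u)@_m' = c * u@_m' by rewrite mcoeffZ.
have cum : (mlead (c *: u) <= m)%O by rewrite -um mleadZ_le.
have If' : ideal_of G1 (f - c *: u) by apply: ideal_of_sub => //; rewrite -mul_mpolyC; apply: ideal_of_mul.
have Ig' : ideal_of G2 (g + c *: u) by apply: ideal_of_add => //; rewrite -mul_mpolyC; apply: ideal_of_mul.
have f'm : (mlead (f - c *: u) <= m)%O by apply: le_trans (mleadB_le _ _) _; rewrite leUx lexx.
have g'm : (mlead (g + c *: u) <= m)%O by apply: le_trans (mleadD_le _ _) _; rewrite leUx -E lexx.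
have f'0 : (f - c *: u)@_m = 0 by rewrite mcoeffB cu uc mulr1 subrr.
have g'0 : (g + c *: u)@_m = 0.
  by move: c0; rewrite fgE mcoeffD f'0 add0r.
move: fg0; rewrite fgE.
have [->|fn] := eqVneq (f - c *: u) 0; first by rewrite add0r => gn; right; apply: I2.
have [->|gn] := eqVneq (g + c *: u) 0; first by rewrite addr0 => _; left; apply: I1.
have lf := mlead_lt_of_coef0 f'm f'0 fn; have lg := mlead_lt_of_coef0 g'm g'0 gn.
apply: (IH (mlead (f - c *: u) `|` mlead (g + c *: u))%O) => //; rewrite ?leUl ?leUr //.
by apply: lt_le_trans fM; rewrite ltUx lf lg.
Qed.

(** The leading monomials of [d * p] and [p] agree on [A], so if the former lies in [D], so does the
    latter. Subtracting an element of the ideal with the same leading term then lowers [p]. *)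
Lemma initial_by_nzd G D A d p :
  initial_by G D -> depends_on D A -> d != 0 -> (forall y, A y -> mlead d y = 0%N) ->
  ideal_of G (d * p) -> ideal_of G p.
Proof.
move=> [IG JG] dep d0 dA; elim/mleadrect: p => p IH Idp.
have [->|p0] := eqVneq p 0; first exact: ideal_of0.
have [g [Ig gm gc]] : exists g, [/\ ideal_of G g, mlead g = mlead p & g@_(mlead p) = 1].
  apply: JG; apply: dep (IG _ Idp _); last by rewrite mulf_neq0.
  by move=> y Ay; rewrite mleadM // mnmDE dA.
have -> : p = (p - p@_(mlead p) *: g) + p@_(mlead p) *: g by rewrite subrK.
have Icg : ideal_of G (p@_(mlead p) *: g) by rewrite -mul_mpolyC; apply: ideal_of_mul.
apply: ideal_of_add => //.
have [->|q0] := eqVneq (p - p@_(mlead p) *: g) 0; first exact: ideal_of0.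
apply: IH; last by rewrite mulrBr; apply: ideal_of_sub => //; apply: ideal_of_mul.
apply: mlead_lt_of_coef0 => //; last by rewrite mcoeffB mcoeffZ gc mulr1 subrr.
by apply: le_trans (mleadB_le _ _) _; rewrite leUx lexx -{2}gm mleadZ_le.
Qed.

Lemma initial_by_family (T : eqType) (bs : seq T) (G : T -> {mpoly K[N]} -> Prop)
    (D : T -> 'X_{1..N} -> Prop) (A : T -> pred 'I_N) :
  uniq bs -> (forall t, t \in bs -> initial_by (G t) (D t)) ->
  (forall t, t \in bs -> depends_on (D t) (A t)) ->
  (forall t t' y, t \in bs -> t' \in bs -> A t y -> A t' y -> t = t') ->
  initial_by (fun g => exists2 t, t \in bs & G t g) (fun m => exists2 t, t \in bs & D t m).
Proof.
have ext G1 G2 D1 D2 : (forall g, G1 g <-> G2 g) -> (forall m, D1 m <-> D2 m) ->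
    initial_by G1 D1 -> initial_by G2 D2.
  move=> eG eD [H1 H2]; split=> [p Ip p0|m /eD/H2 [g [Ig ? ?]]].
    by apply/eD/H1 => //; apply: ideal_of_mono Ip => g /eG; apply: ideal_of_gen.
  by exists g; split=> //; apply: ideal_of_mono Ig => h /eG; apply: ideal_of_gen.
elim: bs => [|t bs IH] /= => [_ _ _ _|/andP[tbs ubs] HI HD HA].
  split=> [p|m []//]; elim=> [|a g r []//]; by rewrite eqxx.
have sub t' : t' \in bs -> t' \in t :: bs by rewrite inE => ->; rewrite orbT.
pose A' y := has (fun t' => A t' y) bs.
apply: (@ext _ _ _ _ _ _ (@initial_by_sum (G t) (fun g => exists2 t, t \in bs & G t g) (D t)
  (fun m => exists2 t, t \in bs & D t m) (A t) A' _ _ _ _ _)); last first.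
- move=> y Ay /hasP [t' t'bs At'y]; move: tbs.
  by rewrite (HA t t' y) ?t'bs ?mem_head ?sub.
- move=> m m' E [t' t'bs Dm]; exists t' => //; apply: HD Dm; first exact: sub.
  by move=> y Ay; apply: E; apply/hasP; exists t'.
- by apply: HD; rewrite mem_head.
- apply: IH => // [t' /sub|t' /sub|t1 t2 y /sub ? /sub ?]; [exact: HI|exact: HD|exact: HA].
- by apply: HI; rewrite mem_head.
- move=> g; split=> [[|[t' ? ?]]|[t']]; [by exists t; rewrite ?mem_head|by exists t'; rewrite ?sub|].
  by rewrite inE => /orP[/eqP ->|]; [left|right; exists t'].
- move=> g; split=> [[|[t' ? ?]]|[t']]; [by exists t; rewrite ?mem_head|by exists t'; rewrite ?sub|].
  by rewrite inE => /orP[/eqP ->|]; [left|right; exists t'].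
Qed.

Definition max_minor (z : nat -> nat -> 'I_N) (s k : nat) g : Prop :=
  exists2 c : nat -> nat, (forall j, (j < s)%N -> (c j < k)%N) &
    g = \det (\matrix_(i < s, j < s) 'X_(z i (c j))).

(** The nontrivial inclusion: an element of the ideal with a leading monomial outside [has_diag]
    would reduce to a nonzero normal one. [normal_nonvanishing] gives a point where this one is
    nonzero although a nonzero functional annihilates all columns, so that all maximal minors vanish
    there. *)
Lemma initial_by_max_minors (z : nat -> nat -> 'I_N) s k : column_major z s k ->
  initial_by (max_minor z s k) (fun m => has_diag z m k s).
Proof.
move=> zP.
have J m : has_diag z m k s -> exists g, [/\ ideal_of (max_minor z s k) g, mlead g = m & g@_m = 1].
  move=> /has_diagP [c Hc].
  have ck i : (i < s)%N -> (c i < k)%N by move=> si; have [_ _ ? _] := Hc _ si; lia.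
  pose z' i j := z i (c j).
  have z'P : column_major z' s s.
    move=> i j i' j' si si' sj sj' lt; apply: zP => //; rewrite ?ck //.
    by case/orP: lt => [lt|/andP[/eqP -> ->]]; [have [_ _ _ ->] := Hc _ sj'|rewrite eqxx orbT].
  have [dm dc] := mlead_det K z'P.
  set d := \det _ in dm dc.
  have le : (diag_mnm z' s <= m)%MM.
    apply/mnm_lepP => l; have [->//|] := posnP (diag_mnm z' s l).
    rewrite diag_mnm_gt0 => /existsP [i /eqP <-].
    have [m0 _ _ _] := Hc _ (ltn_ord i); apply: leq_trans m0.
    rewrite /diag_mnm mnm_sumE (bigD1 i) //= mnm1E eqxx big1 // => i' ne.
    rewrite mnm1E; case: eqP => // /(column_major_inj z'P) [] //.
    by move=> E; move: ne; rewrite (val_inj E) eqxx.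
  exists ('X_[m - diag_mnm z' s] * d); have d0 : d != 0.
    by apply/eqP=> E; move: dc; rewrite E mcoeff0 => /esym/eqP; rewrite oner_eq0.
  split.
  - apply/ideal_of_mul/ideal_of_gen; exists c => //.
  - rewrite mleadM ?mleadXm ?dm ?submK //.
    by apply/eqP=> /(congr1 (mcoeff (m - diag_mnm z' s))); rewrite mcoeffX eqxx mcoeff0 => /eqP; rewrite oner_eq0.
  - by have := mleadcM 'X_[m - diag_mnm z' s] d; rewrite mleadXm dm submK // mcoeffX eqxx dc mulr1.
split=> // p Ip p0; apply: contraT => nD; exfalso.
have red q : exists r, [/\ ideal_of (max_minor z s k) (q - r),
    forall m, m \in msupp r -> ~~ has_diag z m k s & forall m, m \in msupp r -> (m <= mlead q)%O].
  elim/mleadrect: q => q IH.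
  have [->|q0] := eqVneq q 0.
    by exists 0; split; rewrite ?subr0 ?msupp0 //; exact: ideal_of0.
  have [Dq|nDq] := boolP (has_diag z (mlead q) k s).
    have [g [Ig gm gc]] := J _ Dq.
    have Icg : ideal_of (max_minor z s k) (q@_(mlead q) *: g) by rewrite -mul_mpolyC; apply: ideal_of_mul.
    have [E|q'0] := eqVneq (q - q@_(mlead q) *: g) 0.
      exists 0; split; rewrite ?subr0 ?msupp0 //.
      by move/eqP: E; rewrite subr_eq0 => /eqP ->.
    have lt : (mlead (q - q@_(mlead q) *: g) < mlead q)%O.
      apply: mlead_lt_of_coef0 => //; last by rewrite mcoeffB mcoeffZ gc mulr1 subrr.
      by apply: le_trans (mleadB_le _ _) _; rewrite leUx lexx -{2}gm mleadZ_le.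
    have [r [Ir nr lr]] := IH _ lt; exists r; split=> // [|m /lr /le_lt_trans/(_ lt)/ltW //].
    by rewrite -[q](subrK (q@_(mlead q) *: g)) addrAC; apply: ideal_of_add.
  set c := q@_(mlead q); set m := mlead q.
  have [E|q'0] := eqVneq (q - c *: 'X_[m]) 0.
    exists q; rewrite subrr; move/eqP: E; rewrite subr_eq0 => /eqP E; split; first exact: ideal_of0.
      by move=> m'; rewrite E => /msuppZ_le; rewrite msuppX inE => /eqP ->.
    by move=> m' /msupp_le_mlead.
  have lt := ltm_mleadD q0 q'0.
  have [r [Ir nr lr]] := IH _ lt; exists (c *: 'X_[m] + r); split.
  - by rewrite opprD addrA.
  - by move=> m' /msuppD_le; rewrite mem_cat => /orP[/msuppZ_le|/nr//]; rewrite msuppX inE => /eqP ->.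
  - move=> m' /msuppD_le; rewrite mem_cat => /orP[/msuppZ_le|/lr H]; first by rewrite msuppX inE => /eqP ->.
    exact: le_trans H (ltW lt).
(* Only the tail of [p] is divided. The bound on the monomials of the remainder in [red] keeps the
   leading term of [p] from being cancelled, so the result is nonzero. *)
have [r [Ir nr r0]] : exists r, [/\ ideal_of (max_minor z s k) r,
    forall m, m \in msupp r -> ~~ has_diag z m k s & r != 0].
  set c := p@_(mlead p); set m := mlead p.
  have [E|q'0] := eqVneq (p - c *: 'X_[m]) 0.
    exists p; split=> // m'; move/eqP: E; rewrite subr_eq0 => /eqP ->.
    by move/msuppZ_le; rewrite msuppX inE => /eqP ->.
  have [r [Ir nr lr]] := red (p - c *: 'X_[m]).
  exists (c *: 'X_[m] + r); split.
  - have -> : c *: 'X_[m] + r = p - (p - c *: 'X_[m] - r) by rewrite !opprB addrCA [_ + (_ - p)]addrCA subrr addr0 addrC.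
    exact: ideal_of_sub.
  - by move=> m' /msuppD_le; rewrite mem_cat => /orP[/msuppZ_le|/nr//]; rewrite msuppX inE => /eqP ->.
  - apply/eqP => /(congr1 (mcoeff m)); rewrite mcoeffD mcoeffZ mcoeffX eqxx mulr1 mcoeff0.
    have -> : r@_m = 0.
      apply/eqP; rewrite mcoeff_eq0; apply/negP => /[dup] sm /lr.
      by have := ltm_mleadD p0 q'0; rewrite -/c -/m => lt /le_lt_trans/(_ lt); rewrite ltxx.
    by rewrite addr0 => /eqP; rewrite mleadc_eq0 (negbTE p0).
have [L [h [v [f [[s0 nz] fs Hlt _]]]]] := normal_nonvanishing zP (leqnn _) (leqnn _) r0 nr.
move/eqP: nz; apply; elim: Ir => [|a g q [c ck ->] _ IH]; first by rewrite rmorph0.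
rewrite rmorphD /= IH addr0 rmorphM /= -det_map_mx.
apply/eqP; rewrite mulf_eq0; apply/orP; right; apply/det0P.
exists (\row_i f i).
  apply/eqP=> /rowP /(_ (Ordinal (ltac:(by rewrite prednK) : (s.-1 < s)%N))); rewrite !mxE /= => E.
  by rewrite E eqxx in fs.
apply/rowP=> j; rewrite !mxE -[RHS](Hlt (c j)) ?ck //.
by apply: eq_bigr => i _; rewrite !mxE /= mmapX mmap1U.
Qed.

End Groebner.

(** * Families of minors in a polynomial ring *)

(** The universal property and, in place of uniqueness, an induction principle. The ring is accessed
    only through substitutions, so the given tower of univariate polynomials can be exchanged for a
    multivariate ring with any labelling of its variables. *)
Definition polynomial_ring (K : fieldType) (m n : nat) (S : comNzRingType)
    (C : {rmorphism K -> S}) (x : nat -> nat -> S) : Prop :=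
  (forall (R : comNzRingType) (h : {rmorphism K -> R}) (v : nat -> nat -> R),
     exists g : {rmorphism S -> R}, (forall c, g (C c) = h c) /\
       forall i a, (i < m)%N -> (a < n)%N -> g (x i a) = v i a) /\
  (forall P : S -> Prop, (forall c, P (C c)) ->
     (forall i a, (i < m)%N -> (a < n)%N -> P (x i a)) ->
     (forall p q, P p -> P q -> P (p + q)) -> (forall p q, P p -> P q -> P (p * q)) ->
     forall p, P p).

Definition minor (R : comNzRingType) (x : nat -> nat -> R) (rows cols : seq nat) : R :=
  \det (\matrix_(i < size rows, j < size rows) x (nth 0%N rows i) (nth 0%N cols j)).

Notation block := (seq nat * seq nat)%type.

Definition minor_in (R : comNzRingType) (x : nat -> nat -> R) (b : block) (g : R) : Prop :=
  exists c : seq nat, [/\ size c = size b.1, {subset c <= b.2} & g = minor x b.1 c].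

Definition minors_in (R : comNzRingType) (x : nat -> nat -> R) (bs : seq block) (g : R) : Prop :=
  exists2 b, b \in bs & minor_in x b g.

(* The variables occurring in the initial monomials of the maximal minors of [b]. *)
Definition lead_var (b : block) (i a : nat) : bool :=
  [&& i \in b.1, a \in b.2, (index i b.1 <= index a b.2)%N &
      (index a b.2 + size b.1 <= index i b.1 + size b.2)%N].

Lemma minor_morph (R R' : comNzRingType) (h : {rmorphism R -> R'}) x x' rows cols :
  size cols = size rows ->
  (forall i a, i \in rows -> a \in cols -> h (x i a) = x' i a) ->
  h (minor x rows cols) = minor x' rows cols.
Proof.
move=> sc H; rewrite /minor -det_map_mx; congr (\det _); apply/matrixP=> i j.
by rewrite !mxE H // mem_nth // ?sc.
Qed.

Section Labelling.
Variables (K : fieldType) (m n : nat) (S : idomainType).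
Variables (C : {rmorphism K -> S}) (x : nat -> nat -> S).
Hypothesis Spoly : polynomial_ring m n C x.
Variables (sigma tau : nat -> nat) (bs : seq block).
Hypothesis tau_lt : forall i, (i < m)%N -> (tau i < m)%N.
Hypothesis tau_inj : forall i i', (i < m)%N -> (i' < m)%N -> tau i = tau i' -> i = i'.
Hypothesis sigma_inj : forall a a', (a < n)%N -> (a' < n)%N -> sigma a = sigma a' -> a = a'.

Definition rsorted := sorted (relpre tau ltn).
Definition csorted := sorted (relpre sigma ltn).

Definition adapted (b : block) : bool :=
  [&& rsorted b.1, csorted b.2, all (gtn m) b.1 & all (gtn n) b.2].

Hypothesis bs_uniq : uniq bs.
Hypothesis bs_adapted : all adapted bs.
Hypothesis bs_disjoint : forall b b' i a, b \in bs -> b' \in bs ->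
  lead_var b i a -> lead_var b' i a -> b = b'.

(** A bound on all labels, so that [inord] below is exact. The labels compare columns by [sigma]
    first and then rows by [tau], which makes them column-major. *)
Let B := ((\max_(a < n) sigma a) * m + m)%N.
Let idx (i a : nat) : 'I_B.+1 := inord (sigma a * m + tau i).
Let xM (i a : nat) : {mpoly K[B.+1]} := 'X_(idx i a).

Let idxE i a : (i < m)%N -> (a < n)%N -> idx i a = (sigma a * m + tau i)%N :> nat.
Proof.
move=> im an; rewrite inordK // ltnS /B leq_add ?leq_mul2r ?(ltnW (tau_lt im)) //.
by rewrite (leq_bigmax (Ordinal an)) orbT.
Qed.

Let idx_inj i a i' a' : (i < m)%N -> (a < n)%N -> (i' < m)%N -> (a' < n)%N ->
  idx i a = idx i' a' -> i = i' /\ a = a'.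
Proof.
move=> im an im' an' /(congr1 val); rewrite /= !idxE // => E.
have t := tau_lt im; have t' := tau_lt im'.
have Es : sigma a = sigma a'.
  by have := congr1 (divn^~ m) E; rewrite !divnMDl ?divn_small ?addn0 //; lia.
by move: E; rewrite Es => /addnI/tau_inj ->; rewrite ?(sigma_inj an an' Es).
Qed.

Let rtrans : transitive (relpre tau ltn). Proof. by move=> ? ? ? /=; apply: ltn_trans. Qed.
Let ctrans : transitive (relpre sigma ltn). Proof. by move=> ? ? ? /=; apply: ltn_trans. Qed.
Let runiq r : rsorted r -> uniq r.
Proof. by apply: sorted_uniq => // a; rewrite /= ltnn. Qed.
Let cuniq c : csorted c -> uniq c.
Proof. by apply: sorted_uniq => // a; rewrite /= ltnn. Qed.

Let zb (b : block) (i j : nat) := idx (nth 0%N b.1 i) (nth 0%N b.2 j).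

Let zb_major b : adapted b -> column_major (zb b) (size b.1) (size b.2).
Proof.
case/and4P => rs cs /allP/= rm /allP/= cn i j i' j' si si' sj sj' lt.
have := rm _ (mem_nth 0%N si); have := rm _ (mem_nth 0%N si').
have := cn _ (mem_nth 0%N sj); have := cn _ (mem_nth 0%N sj') => ? ? ? ?.
rewrite /zb !idxE //; case/orP: lt => [lt|/andP[/eqP -> lt]]; last first.
  by rewrite ltn_add2l; apply: (sorted_ltn_nth rtrans 0%N rs).
have : (sigma (nth 0%N b.2 j) < sigma (nth 0%N b.2 j'))%N by apply: (sorted_ltn_nth ctrans 0%N cs).
rewrite -(leq_pmul2r (_ : 0 < m)%N); last by lia.
have : (tau (nth 0%N b.1 i) < m)%N by apply: tau_lt.
by rewrite mulSn; lia.
Qed.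

Let gensM := minors_in xM bs.

Let initM b : adapted b ->
  initial_by (minor_in xM b) (fun mu => has_diag (zb b) mu (size b.2) (size b.1)).
Proof.
move=> /zb_major /(initial_by_max_minors K) [H1 H2]; split=> [p Ip|mu /H2 [g [Ig ? ?]]].
  apply: H1; apply: ideal_of_mono Ip => g [c [sc sub ->]]; apply: ideal_of_gen.
  exists (fun j => index (nth 0%N c j) b.2) => [j sj|].
    by rewrite index_mem sub // mem_nth ?sc.
  congr (\det _); apply/matrixP=> i j; rewrite !mxE /xM /zb nth_index //.
  by rewrite sub // mem_nth ?sc.
exists g; split=> //; apply: ideal_of_mono Ig => _ [c ck ->]; apply: ideal_of_gen.
exists (mkseq (fun j => nth 0%N b.2 (c j)) (size b.1)); rewrite size_mkseq; split=> //.
  by move=> a /mapP [j]; rewrite mem_iota => /andP[_ js] ->; rewrite mem_nth ?ck.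
by congr (\det _); apply/matrixP=> i j; rewrite !mxE nth_mkseq.
Qed.

Let suppM b y : adapted b -> diag_support (zb b) (size b.1) (size b.2) y ->
  exists i a, [/\ lead_var b i a, (i < m)%N, (a < n)%N & y = idx i a].
Proof.
case/and4P => rs cs /allP/= rm /allP/= cn /existsP [i /existsP [j /and3P[ij js /eqP ->]]].
exists (nth 0%N b.1 i), (nth 0%N b.2 j); split=> //; rewrite ?rm ?cn ?mem_nth //.
rewrite /lead_var !mem_nth //= (index_uniq _ _ (runiq rs)) // (index_uniq _ _ (cuniq cs)) //.
by apply/andP.
Qed.

Let initMs : initial_by gensM (fun mu => exists2 b, b \in bs &
   has_diag (zb b) mu (size b.2) (size b.1)).
Proof.
apply: (@initial_by_family _ _ _ _ _ _ (fun b => diag_support (zb b) (size b.1) (size b.2))) => //.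
- by move=> b /(allP bs_adapted)/initM.
- by move=> b _; apply: has_diag_depends.
move=> b b' y bbs b'bs /(suppM (allP bs_adapted _ bbs)) [i [a [l im an ->]]].
move=> /(suppM (allP bs_adapted _ b'bs)) [i' [a' [l' im' an' /idx_inj []]]] // E1 E2.
by subst; apply: bs_disjoint l l'.
Qed.

Let mem_adapted b i a : b \in bs -> (i \in b.1 -> (i < m)%N) /\ (a \in b.2 -> (a < n)%N).
Proof. by move=> /(allP bs_adapted) /and4P [_ _ /allP/= H1 /allP/= H2]; split=> [/H1|/H2]. Qed.

(** The target may have more variables than [S], as labels can have gaps. Sending the surplus
    variables to 0 gives the retraction [r], which is what reflects ideal membership. *)
Let embedding : exists (e : {rmorphism S -> {mpoly K[B.+1]}}) (r : {rmorphism {mpoly K[B.+1]} -> S}),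
  [/\ forall c, e (C c) = c%:MP, forall i a, (i < m)%N -> (a < n)%N -> e (x i a) = xM i a,
      forall p, r (e p) = p & forall p, ideal_of (minors_in x bs) p <-> ideal_of gensM (e p)].
Proof.
have [e [eC ex]] := Spoly.1 _ (@mpolyC B.+1 K) xM.
pose v (y : 'I_B.+1) : S := if [pick ia : 'I_m * 'I_n | y == idx ia.1 ia.2] is Some ia then x ia.1 ia.2 else 0.
have vE i a : (i < m)%N -> (a < n)%N -> v (idx i a) = x i a.
  move=> im an; rewrite /v; case: pickP => [[i' a'] /= /eqP /idx_inj []//|]; first by move=> -> ->.
  by move=> /(_ (Ordinal im, Ordinal an)); rewrite eqxx.
pose r : {rmorphism _ -> _} := mmap C v.
have rx i a : (i < m)%N -> (a < n)%N -> r (xM i a) = x i a.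
  by move=> im an; rewrite /= mmapX mmap1U vE.
have re p : r (e p) = p.
  elim/Spoly.2: p => [c|i a im an|p q Hp Hq|p q Hp Hq].
  - by rewrite eC /= mmapC.
  - by rewrite ex ?rx.
  - by rewrite !rmorphD /= Hp Hq.
  - by rewrite !rmorphM /= Hp Hq.
exists e, r; split=> // p; split.
  apply: ideal_of_morph => _ [b bbs [c [sc sub ->]]]; apply: ideal_of_gen; exists b => //.
  exists c; split=> //; apply: minor_morph => // i a ib /sub ab.
  by apply: ex; [apply: (mem_adapted i a bbs).1|apply: (mem_adapted i a bbs).2].
rewrite -{2}(re p).
apply: ideal_of_morph => _ [b bbs [c [sc sub ->]]]; apply: ideal_of_gen; exists b => //.
exists c; split=> //; apply: minor_morph => // i a ib /sub ab.
by apply: rx; [apply: (mem_adapted i a bbs).1|apply: (mem_adapted i a bbs).2].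
Qed.

(** The leading monomial of this minor is its diagonal, and the condition on [lead_var] keeps the
    diagonal off the initial variables of all blocks, so [initial_by_nzd] applies. *)
Lemma minor_nzd rows cols p : rsorted rows -> csorted cols -> size cols = size rows ->
  all (gtn m) rows -> all (gtn n) cols ->
  (forall b l, b \in bs -> (l < size rows)%N -> ~~ lead_var b (nth 0%N rows l) (nth 0%N cols l)) ->
  ideal_of (minors_in x bs) (minor x rows cols * p) -> ideal_of (minors_in x bs) p.
Proof.
move=> rs cs sc rm cn lv; have [e [r [eC ex re eI]]] := embedding.
move=> /eI Idp; apply/eI; move: Idp; rewrite rmorphM.
rewrite (@minor_morph _ _ e x xM) //; last first.
  by move=> i a ir ac; apply: ex; [apply: (allP rm)|apply: (allP cn)].
have := @zb_major (rows, cols); rewrite /adapted /= rs cs rm cn sc => /(_ isT).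
case/(mlead_det K) => dm dc.
apply: (initial_by_nzd initMs (A := fun y => has (fun b => diag_support (zb b) (size b.1) (size b.2) y) bs)).
- move=> mu mu' E [b bbs Hb]; exists b => //; apply: has_diag_depends Hb => y Hy.
  by apply: E; apply/hasP; exists b.
- by apply/eqP=> E; move: dc; rewrite /zb /= -/(minor _ _ _) -/(xM _ _) in E *; rewrite -[\det _]/(minor xM rows cols) E mcoeff0 => /esym/eqP; rewrite oner_eq0.
- move=> y /hasP [b bbs /(suppM (allP bs_adapted _ bbs)) [i [a [l im an ->]]]].
  rewrite [mlead _]dm; apply/eqP; rewrite -leqn0 leqNgt diag_mnm_gt0; apply/existsP => -[k /eqP].
  have kc : (k < size cols)%N by rewrite sc.
  have rk : (nth 0%N rows k < m)%N by apply: (allP rm); rewrite mem_nth.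
  have ck : (nth 0%N cols k < n)%N by apply: (allP cn); rewrite mem_nth.
  case/(idx_inj rk ck im an).
  by move=> E1 E2; have := lv b k bbs (ltn_ord k); rewrite E1 E2 l.
Qed.

(** A polynomial fixed by [h] has no monomial with a variable in [U]. A nonzero one in the ideal
    would have a leading monomial containing a diagonal of some block, in particular a variable from
    the row of that block in which all initial variables lie in [U]. *)
Lemma no_relation_among_free (U : nat -> nat -> bool) (h : {rmorphism S -> S}) p :
  (forall c, h (C c) = C c) ->
  (forall i a, (i < m)%N -> (a < n)%N -> h (x i a) = if U i a then 0 else x i a) ->
  (forall b, b \in bs -> exists2 i, i \in b.1 & forall a, lead_var b i a -> U i a) ->
  h p = p -> ideal_of (minors_in x bs) p -> p = 0.
Proof.
move=> hC hx HU hp; have [e [r [eC ex re eI]]] := embedding => /eI Iep.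
apply/eqP; apply: contraT => p0; exfalso.
have ep0 : e p != 0 by apply: contraNneq p0 => E; rewrite -(re p) E rmorph0.
have [b bbs] := initMs.1 _ Iep ep0; case/has_diagP => c Hc.
have [i0 i0b HUb] := HU _ bbs.
have ib : (index i0 b.1 < size b.1)%N by rewrite index_mem.
have [c0 c1 c2 _] := Hc _ ib.
have /and4P [rs cs /allP/= rm /allP/= cn] := allP bs_adapted _ bbs.
set j := c _ in c0 c1 c2; have jb : (j < size b.2)%N by lia.
have := HUb (nth 0%N b.2 j); rewrite /lead_var i0b mem_nth // index_uniq ?cuniq // c1 c2 => /(_ isT) Uy.
have i0m := rm _ i0b; have jn := cn _ (mem_nth 0%N jb).
rewrite /zb nth_index // in c0; set a0 := nth 0%N b.2 j in c0 Uy jn.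
pose killed (y : 'I_B.+1) := [exists i : 'I_m, exists a : 'I_n, U i a && (y == idx i a)].
pose hM : {rmorphism _ -> _} := mmap (@mpolyC B.+1 K) (fun y => if killed y then 0 else 'X_y).
have hMe q : e (h q) = hM (e q).
  elim/Spoly.2: q => [d|i a im an|q q' Hp Hq|q q' Hp Hq].
  - by rewrite hC eC /= mmapC.
  - rewrite hx // ex // /= mmapX mmap1U; case Uia: (U i a).
      rewrite rmorph0 ifT //.
      by rewrite /killed; apply/existsP; exists (Ordinal im); apply/existsP; exists (Ordinal an); rewrite /= Uia eqxx.
    case: ifP; last by rewrite ex.
    rewrite /killed; case/existsP => i' /existsP [a' /andP [Uia' /eqP /idx_inj []]] // E1 E2.
    by rewrite E1 E2 Uia' in Uia.
  - by rewrite !rmorphD Hp Hq.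
  - by rewrite !rmorphM Hp Hq.
have kill : killed (idx i0 a0).
  by rewrite /killed; apply/existsP; exists (Ordinal i0m); apply/existsP; exists (Ordinal jn); rewrite /= Uy eqxx.
set mu := mlead (e p) in c0.
have : (e p)@_mu != 0 by rewrite mleadc_eq0.
(* The leading coefficient is recomputed from [hM (e p)], to which a monomial with a killed variable
   contributes nothing. *)
rewrite -{1}hp hMe /= /mmap raddf_sum big1 ?eqxx // => nu _ /=.
rewrite mcoeffCM /mmap1.
have [Hk|nk] := boolP (has (fun y => killed y && (0 < nu y)%N) (enum 'I_B.+1)).
  have [y _ /andP[ky ny]] := hasP Hk.
  by rewrite (bigD1 y) //= ky expr0n -[_ == 0%N]negbK -lt0n ny mul0r mcoeff0 mulr0.
have nk' y : ~~ (killed y && (0 < nu y)%N) by apply: (hasPn nk); rewrite mem_enum.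
rewrite (eq_bigr (fun y => 'X_y ^+ nu y)); last first.
  move=> y _; have := nk' y; rewrite negb_and -leqNgt leqn0 => /orP[/negbTE -> //|/eqP ->].
  by rewrite !expr0.
rewrite -mpolyXE_id mcoeffX; case: eqP => [E|]; last by rewrite mulr0.
by have := nk' (idx i0 a0); rewrite kill E c0.
Qed.

End Labelling.

(** * The ring [Sring] as a polynomial ring *)

Fixpoint tower_const (K : idomainType) (N : nat) : {rmorphism K -> Defs.mpoly K N} :=
  match N return {rmorphism K -> Defs.mpoly K N} with
  | 0 => idfun
  | N'.+1 => polyC \o tower_const K N'
  end.

Lemma tower_eval (K : idomainType) N (R : comNzRingType) (h : {rmorphism K -> R}) (v : nat -> R) :
  exists g : {rmorphism Defs.mpoly K N -> R},
    (forall c, g (tower_const K N c) = h c) /\ forall k, (k < N)%N -> g (mvar K N k) = v k.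
Proof.
elim: N => [|N [g [gC gx]]]; first by exists h.
have cgv : commr_rmorph g (v N) by move=> a; apply: mulrC.
exists (horner_morph cgv); split=> [c|k].
  by rewrite /= horner_morphC.
rewrite ltnS leq_eqVlt /=; case: eqP => [-> _|_ /= kN]; first by rewrite horner_morphX.
by rewrite horner_morphC gx.
Qed.

Lemma tower_ind (K : idomainType) N (P : Defs.mpoly K N -> Prop) :
  (forall c, P (tower_const K N c)) -> (forall k, (k < N)%N -> P (mvar K N k)) ->
  (forall p q, P p -> P q -> P (p + q)) -> (forall p q, P p -> P q -> P (p * q)) ->
  forall p, P p.
Proof.
elim: N P => [|N IH] P PC Px Padd Pmul; first exact: PC.
have PX : P 'X by have := Px N (ltnSn N); rewrite /= eqxx.
have Pc c : P c%:P.
  apply: (IH (fun c => P c%:P)) => [d|k kN|p q Pp Pq|p q Pp Pq].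
  - exact: PC.
  - by have := Px k (ltnW kN); rewrite /= ltn_eqF.
  - by rewrite polyCD; apply: Padd.
  - by rewrite polyCM; apply: Pmul.
elim/poly_ind => [|p c Pp]; first by rewrite -polyC0; apply: Pc.
by apply: Padd (Pc c); apply: Pmul Pp PX.
Qed.

Lemma Sring_polynomial (K : fieldType) m n :
  polynomial_ring m n (tower_const K (m * n)) (xvar K m n).
Proof.
have lt i a : (i < m)%N -> (a < n)%N -> (i * n + a < m * n)%N by nia.
split=> [R h v|P PC Px Padd Pmul].
  have [g [gC gx]] := @tower_eval K (m * n) R h (fun k => v (k %/ n)%N (k %% n)%N).
  exists g; split=> // i a im an; rewrite /xvar gx ?lt //.
  by rewrite divnMDl ?(leq_trans _ an) // divn_small // addn0 modnMDl modn_small.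
apply: tower_ind => // k kmn; have n0 : (0 < n)%N by lia.
rewrite (divn_eq k n); apply: Px; last by rewrite ltn_mod.
by rewrite ltn_divLR.
Qed.

(** * Pivoting on a shared column *)

Definition delete (j : nat) (c : seq nat) := mkseq (fun l => nth 0%N c (bump j l)) (size c).-1.

Lemma size_delete j c : size (delete j c) = (size c).-1.
Proof. by rewrite size_mkseq. Qed.

Lemma mem_delete j c a : a \in delete j c -> a \in c.
Proof.
move=> /(nthP 0%N) [l]; rewrite size_delete => lt <-; rewrite nth_mkseq //; apply: mem_nth.
rewrite /bump; case: (j <= l)%N; rewrite ?add1n ?add0n; move: (size c) lt => [|k] //= lt; exact: leqW.
Qed.

Section MinorExpansion.
Variables (R : comNzRingType) (y : nat -> nat -> R) (r0 : nat) (rows : seq nat).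

Lemma cofactor_minor (c : seq nat) (j : 'I_(size rows).+1) : size c = (size rows).+1 ->
  cofactor (\matrix_(i < (size rows).+1, j < (size rows).+1)
     y (nth 0%N (r0 :: rows) i) (nth 0%N c j)) ord0 j = (-1) ^+ j * minor y rows (delete j c).
Proof.
move=> sc; rewrite /cofactor add0n; congr (_ * \det _).
by apply/matrixP=> i k; rewrite !mxE nth_mkseq ?sc.
Qed.

Lemma minor_expand_row (c : seq nat) : size c = (size rows).+1 ->
  minor y (r0 :: rows) c =
  \sum_(j < (size rows).+1) y r0 (nth 0%N c j) * ((-1) ^+ j * minor y rows (delete j c)).
Proof.
move=> sc; rewrite /minor (expand_det_row _ ord0); apply: eq_bigr => j _.
by rewrite cofactor_minor // mxE.
Qed.

Lemma minor_expand_sparse_col (c : seq nat) j : size c = (size rows).+1 ->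
  (j < size c)%N -> (forall i, i \in rows -> y i (nth 0%N c j) = 0) ->
  minor y (r0 :: rows) c = y r0 (nth 0%N c j) * ((-1) ^+ j * minor y rows (delete j c)).
Proof.
move=> sc; rewrite sc => js H; rewrite /minor (expand_det_col _ (Ordinal js)) (bigD1 ord0) //=.
rewrite cofactor_minor // mxE /= big1 ?addr0 // => i; rewrite -(inj_eq val_inj) /= => i0.
rewrite mxE; case: i i0 => -[|i] //= lt _; rewrite H ?mul0r //.
by rewrite mem_nth.
Qed.

Lemma minor_zero_col (c : seq nat) a : size c = size rows -> a \in c ->
  (forall i, i \in rows -> y i a = 0) -> minor y rows c = 0.
Proof.
move=> sc ac H; have ja : (index a c < size rows)%N by rewrite -sc index_mem.
rewrite /minor (expand_det_col _ (Ordinal ja)) big1 // => i _.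
by rewrite mxE nth_index // H ?mul0r // mem_nth.
Qed.

End MinorExpansion.

Section Pivot.
Variables (K : fieldType) (m n : nat) (S : idomainType).
Variables (C : {rmorphism K -> S}) (x : nat -> nat -> S).
Hypothesis Spoly : polynomial_ring m n C x.
Variables (w : nat) (rows : seq nat) (Cs : seq (seq nat)).
Hypotheses (wn : (w < n)%N) (m0 : (0 < m)%N) (rows_m : all (gtn m) rows) (rows0 : 0%N \notin rows).
Hypothesis Cs_n : forall c, c \in Cs -> all (gtn n) c.

Let t := x 0 w.

Definition full_block (c : seq nat) : block := (0%N :: rows, c).
Definition pivot_block (c : seq nat) : block :=
  if w \in c then (rows, [seq a <- c | a != w]) else full_block c.

Let I := ideal_of (minors_in x (map full_block Cs)).
Let I' := ideal_of (minors_in x (map pivot_block Cs)).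

Hypotheses (t_nzd : forall p, I (t * p) -> I p) (t_nzd' : forall p, I' (t * p) -> I' p).

Let y (i a : nat) : S := if i == 0%N then x 0 a else t * x i a - x i w * x 0 a.

(** Replacing row [i] by [t] times itself minus [x i w] times row 0 is left multiplication by a
    lower triangular matrix, with diagonal entries 1 in row 0 and [t] elsewhere. *)
Lemma minor_row_reduction c : size c = (size rows).+1 ->
  minor y (0%N :: rows) c = t ^+ size rows * minor x (0%N :: rows) c.
Proof.
move=> sc; pose U := \matrix_(i < (size rows).+1, j < (size rows).+1)
  (if i == ord0 then (j == ord0)%:R else t *+ (i == j) - x (nth 0%N (0%N :: rows) i) w *+ (j == ord0)).
have -> : t ^+ size rows = \det U.
  rewrite det_trig.
    rewrite big_ord_recl mxE eqxx mul1r (eq_bigr (fun _ => t)) ?prodr_const ?card_ord //.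
    by move=> i _; rewrite mxE eqxx subr0.
  apply/is_trig_mxP => i j ij; rewrite mxE -!(inj_eq val_inj) /= (ltn_eqF ij).
  have -> : (j == 0%N :> nat) = false by lia.
  by rewrite mulr0n subr0 if_same.
rewrite /minor -det_mulmx; congr (\det _); apply/matrixP=> i j; rewrite !mxE big_ord_recl !mxE /y.
case: (unliftP ord0 i) => [i' ->|->] /=; last first.
  by rewrite mul1r big1 ?addr0 // => k _; rewrite !mxE /= mul0r.
have ir : nth 0%N rows i' \in rows by rewrite mem_nth.
have -> : (nth 0%N rows i' == 0%N) = false by apply: contraNF rows0 => /eqP <-.
rewrite mulr0n sub0r (bigD1 i') //= !mxE eqxx /= subr0 big1 ?addr0 => [|k ki].
  by rewrite mulr1n mulNr addrC.
rewrite !mxE /= subr0 -[lift ord0 i' == _]/(lift ord0 i' == lift ord0 k).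
by rewrite (inj_eq lift_inj) eq_sym (negbTE ki) mulr0n mul0r.
Qed.

(** The substitution that clears column [w]; it becomes an automorphism once [t] is inverted. *)
Let chi_exists : exists chi : {rmorphism S -> S}, (forall c, chi (C c) = C c) /\
  forall i a, (i < m)%N -> (a < n)%N -> chi (x i a) = if a == w then x i a else y i a.
Proof. exact: Spoly.1. Qed.

Lemma polynomial_var_neq0 i a : (i < m)%N -> (a < n)%N -> x i a != 0.
Proof.
move=> im an; have [g [_ gx]] := Spoly.1 K idfun (fun _ _ => 1).
by apply/eqP=> /(congr1 g); rewrite gx // rmorph0 => /eqP; rewrite oner_eq0.
Qed.

Let t_neq0 : t != 0. Proof. exact: polynomial_var_neq0. Qed.

Let chi_injective (chi : {rmorphism S -> S}) : (forall c, chi (C c) = C c) ->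
  (forall i a, (i < m)%N -> (a < n)%N -> chi (x i a) = if a == w then x i a else y i a) ->
  injective chi.
Proof.
move=> chiC chix; have [Q [F F0]] : exists (Q : fieldType) (F : {rmorphism S -> Q}), forall a, (F a == 0) = (a == 0).
  exact: fraction_embedding.
(* The inverse substitution, which needs the denominator [t] and therefore takes values in the
   fraction field. *)
pose v i a := if (i == 0%N) || (a == w) then F (x i a)
  else (F (x i a) + F (x i w) * F (x 0 a)) / F t.
have [psi [psiC psix]] := Spoly.1 Q (F \o C) v.
suff K1 q : psi (chi q) = F q.
  move=> p q E; apply/eqP; rewrite -subr_eq0 -F0 rmorphB subr_eq0.
  by rewrite -!K1 E.
elim/Spoly.2: q => [c|i a im an|p q Hp Hq|p q Hp Hq].
- by rewrite chiC psiC.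
- rewrite chix // /y; have [->|aw] := eqVneq a w; first by rewrite psix // /v eqxx orbT.
  have [->|i0] := eqVneq i 0%N; first by rewrite psix.
  rewrite rmorphB !rmorphM /= /t !psix // /v eqxx /= (negbTE i0) (negbTE aw) eqxx ?orbT /=.
  by rewrite mulrC divfK ?F0 // addrK.
- by rewrite !rmorphD /= Hp Hq.
- by rewrite !rmorphM /= Hp Hq.
Qed.

Let rows_lt i : i \in 0%N :: rows -> (i < m)%N.
Proof. by rewrite inE => /orP[/eqP -> //|/(allP rows_m)]. Qed.

(** After inverting [t], [chi] carries [I'] to [I]: a minor of the cleared matrix through column [w]
    is, up to sign, [t] times a minor of the pivot block. As [t] is a nonzerodivisor modulo both
    ideals, primeness transfers through the localisation. *)
Lemma pivot_prime : (forall p q, I' (p * q) -> I' p \/ I' q) ->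
  forall p q, I (p * q) -> I p \/ I q.
Proof.
move=> prime'; have [chi [chiC chix]] := chi_exists.
have chi_inj := chi_injective chiC chix.
have chit : chi t = t by rewrite chix // eqxx.
have chitX N : chi (t ^+ N) = t ^+ N by rewrite rmorphXn /= chit.
have chi_minor rs c : size c = size rs -> {subset rs <= 0%N :: rows} -> all (gtn n) c -> w \notin c ->
    chi (minor x rs c) = minor y rs c.
  move=> sc rsub cn wc; apply: minor_morph => // i a ir ac.
  rewrite chix; [|by apply/rows_lt/rsub|exact: (allP cn)].
  by case: eqP ac => // ->; rewrite (negbTE wc).
have rsub : {subset rows <= 0%N :: rows} by move=> i; rewrite inE => ->; rewrite orbT.
have yw i : i \in rows -> y i w = 0.
  move=> ir; rewrite /y; case: eqP => [E|_]; first by rewrite E (negbTE rows0) in ir.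
  by rewrite mulrC subrr.
have y0w : y 0 w = t by [].
have lift_elt p : exists N q, chi q = t ^+ N * p.
  elim/Spoly.2: p => [c|i a im an|p1 p2 [N1 [q1 E1]] [N2 [q2 E2]]|p1 p2 [N1 [q1 E1]] [N2 [q2 E2]]].
  - by exists 0%N, (C c); rewrite mul1r.
  - have [E|aw] := eqVneq a w; first by exists 0%N, (x i a); rewrite mul1r chix // E eqxx.
    have [E|i0] := eqVneq i 0%N; first by exists 0%N, (x i a); rewrite mul1r chix // (negbTE aw) /y E.
    exists 1%N, (x i a + x i w * x 0 a); rewrite expr1 rmorphD rmorphM !chix // (negbTE aw) eqxx.
    by rewrite /y eqxx (negbTE i0) subrK.
  - exists (N1 + N2)%N, (t ^+ N2 * q1 + t ^+ N1 * q2).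
    by rewrite rmorphD !rmorphM /= !chitX E1 E2 exprD; ring.
  - by exists (N1 + N2)%N, (q1 * q2); rewrite rmorphM /= E1 E2 exprD; ring.
have w_expand c : size c = (size rows).+1 -> w \in c ->
    t ^+ size rows * minor x (0%N :: rows) c =
    t * ((-1) ^+ index w c * minor y rows (delete (index w c) c)).
  move=> sc wc; rewrite -minor_row_reduction // (@minor_expand_sparse_col _ y 0%N rows c (index w c)) ?nth_index ?index_mem //.
have chi_I' p : I' p -> I (chi p).
  apply: ideal_of_morph => _ [b /mapP [D DC ->] [c [sc sub ->]]].
  move: sc sub; rewrite /pivot_block; case: ifP => wD /= sc sub.
    have wc : w \notin c by apply/negP => /sub; rewrite mem_filter eqxx.
    have cD : {subset c <= D} by move=> a /sub; rewrite mem_filter => /andP[].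
    have cn : all (gtn n) c by apply/allP => a /cD /(allP (Cs_n DC)).
    apply: t_nzd; rewrite chi_minor //.
    (* Putting the column [w] in front turns the smaller minor into a full one, at the cost of a
       factor [t]. *)
    have sc' : size (w :: c) = (size rows).+1 by rewrite /= sc.
    have /= := w_expand (w :: c) sc' (mem_head _ _); rewrite eqxx expr0 mul1r.
    have -> : delete 0 (w :: c) = c.
      by apply: (@eq_from_nth _ 0%N); rewrite size_mkseq //= => k kc; rewrite nth_mkseq.
    move=> <-; apply/ideal_of_mul/ideal_of_gen; exists (full_block D); first exact: map_f.
    by exists (w :: c); split=> // a; rewrite inE => /orP[/eqP -> //|/cD].
  have cn : all (gtn n) c by apply/allP => a /sub /(allP (Cs_n DC)).
  rewrite chi_minor //; last by apply: contraFN wD; apply: sub.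
  rewrite minor_row_reduction //; apply/ideal_of_mul/ideal_of_gen.
  by exists (full_block D); [exact: map_f|exists c].
have lift_gen g : minors_in x (map full_block Cs) g -> exists N g', I' g' /\ chi g' = t ^+ N * g.
  move=> [b /mapP [D DC ->] [c [/= sc sub ->]]]; exists (size rows).
  have cn : all (gtn n) c by apply/allP => a /sub /(allP (Cs_n DC)).
  have pD : pivot_block D \in map pivot_block Cs by exact: map_f.
  have [wc|wc] := boolP (w \in c); last first.
    rewrite -minor_row_reduction // -chi_minor //; exists (minor x (0%N :: rows) c); split=> //.
    move: pD; rewrite /pivot_block; case: ifP => wD pD; last by apply: ideal_of_gen; exists (full_block D) => //; exists c.
    (* The minor avoids [w] although its clique contains it: expansion along row 0 leaves only
       minors of the pivot block. *)
    rewrite minor_expand_row //; apply: ideal_of_sum => j _.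
    rewrite mulrA; apply/ideal_of_mul/ideal_of_gen; eexists; first exact: pD.
    exists (delete j c); rewrite size_delete sc; split=> // a /= /mem_delete ac.
    by rewrite mem_filter sub // andbT; apply: contraNneq wc => <-.
  rewrite w_expand //; set c' := delete _ c.
  have sc' : size c' = size rows by rewrite size_delete sc.
  have [wc'|wc'] := boolP (w \in c').
    exists 0; rewrite rmorph0 (minor_zero_col sc' wc') ?mulr0 //; split=> //; exact: ideal_of0.
  have c'n : all (gtn n) c' by apply/allP => a /mem_delete /(allP cn).
  rewrite -chi_minor //; exists (t * ((-1) ^+ index w c * minor x rows c')); split; last first.
    by rewrite !rmorphM /= chit rmorphXn rmorphN1.
  rewrite mulrA; apply/ideal_of_mul/ideal_of_gen; exists (pivot_block D) => //.
  rewrite /pivot_block sub //=; exists c'; split=> // a ac'.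
  by rewrite mem_filter sub ?(mem_delete ac') // andbT; apply: contraNneq wc' => <-.
have lift_I p : I p -> exists N q, I' q /\ chi q = t ^+ N * p.
  elim=> [|a g r /lift_gen [N1 [g' [Ig' E1]]] _ [N2 [r' [Ir' E2]]]].
    by exists 0%N, 0; rewrite rmorph0 mulr0; split=> //; exact: ideal_of0.
  have [N [a' Ea]] := lift_elt a.
  exists (N + N1 + N2)%N, (t ^+ N2 * a' * g' + t ^+ (N + N1) * r'); split.
    by apply: ideal_of_add; apply: ideal_of_mul.
  by rewrite rmorphD !rmorphM /= !chitX Ea E1 E2 !exprD; ring.
move=> p1 p2 /lift_I [N [q [Iq Eq]]].
have tX_nzd' M p : I' (t ^+ M * p) -> I' p.
  by elim: M => [|M IH]; rewrite ?mul1r // exprS -mulrA => /t_nzd'.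
have tX_nzd M p : I (t ^+ M * p) -> I p.
  by elim: M => [|M IH]; rewrite ?mul1r // exprS -mulrA => /t_nzd.
have [N1 [q1 E1]] := lift_elt p1; have [N2 [q2 E2]] := lift_elt p2.
have E : t ^+ N * (q1 * q2) = t ^+ (N1 + N2) * q.
  by apply: chi_inj; rewrite !rmorphM /= !chitX E1 E2 Eq exprD; ring.
have /prime' : I' (q1 * q2) by apply: (tX_nzd' N); rewrite E; apply: ideal_of_mul.
by case=> /chi_I'; rewrite ?E1 ?E2 => /tX_nzd; [left|right].
Qed.

End Pivot.

(** * Elimination of variables *)

Section Elimination.
Variables (S : idomainType) (G : S -> Prop) (h : {rmorphism S -> S}).
Let I := ideal_of G.

Definition nonzerodivisor_mod (r : S) : Prop := forall p, I (r * p) -> I p.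

(* [s] becomes, after multiplication by a nonzerodivisor mod [I] that is fixed
   by [h], congruent mod [I] to an element fixed by [h]. *)
Definition eliminable (s : S) : Prop :=
  exists r f, [/\ h r = r, nonzerodivisor_mod r, h f = f & I (r * s - f)].

Lemma nonzerodivisor_modM r r' :
  nonzerodivisor_mod r -> nonzerodivisor_mod r' -> nonzerodivisor_mod (r * r').
Proof. by move=> Hr Hr' p; rewrite -mulrA => /Hr/Hr'. Qed.

Lemma eliminable_fixed f : h f = f -> eliminable f.
Proof.
exists 1, f; split=> //; rewrite ?rmorph1 // ?mul1r ?subrr; last exact: ideal_of0.
by move=> p; rewrite mul1r.
Qed.

Lemma eliminableM s s' : eliminable s -> eliminable s' -> eliminable (s * s').
Proof.
move=> [r [f [hr nr hf E]]] [r' [f' [hr' nr' hf' E']]]; exists (r * r'), (f * f'); split.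
- by rewrite rmorphM hr hr'.
- exact: nonzerodivisor_modM.
- by rewrite rmorphM hf hf'.
have -> : r * r' * (s * s') - f * f' = r' * s' * (r * s - f) + f * (r' * s' - f') by ring.
by apply: ideal_of_add; apply: ideal_of_mul.
Qed.

Lemma eliminableD s s' : eliminable s -> eliminable s' -> eliminable (s + s').
Proof.
move=> [r [f [hr nr hf E]]] [r' [f' [hr' nr' hf' E']]]; exists (r * r'), (r' * f + r * f'); split.
- by rewrite rmorphM hr hr'.
- exact: nonzerodivisor_modM.
- by rewrite rmorphD !rmorphM hf hf' hr hr'.
have -> : r * r' * (s + s') - (r' * f + r * f') = r' * (r * s - f) + r * (r' * s' - f') by ring.
by apply: ideal_of_add; apply: ideal_of_mul.
Qed.

Lemma eliminableN1 N : eliminable ((-1) ^+ N).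
Proof. by apply: eliminable_fixed; rewrite rmorphXn rmorphN1. Qed.

(** Modulo the ideal, [r' * f] is [r' * r * a], a product of nonzerodivisors; multiplying
    [a * s + b] by [r * r'] shows that it takes [s] to [- r * f']. *)
Lemma eliminable_solve a b s :
  eliminable a -> nonzerodivisor_mod a -> eliminable b -> I (a * s + b) -> eliminable s.
Proof.
move=> [r [f [hr nr hf E]]] na [r' [f' [hr' nr' hf' E']]] Is.
exists (r' * f), (- r * f'); split.
- by rewrite rmorphM hr' hf.
- move=> p; rewrite -mulrA => /nr' Ip; apply: na; apply: nr.
  have -> : r * (a * p) = (r * a - f) * p + f * p by ring.
  by apply: ideal_of_add => //; rewrite mulrC; apply: ideal_of_mul.
- by rewrite rmorphM rmorphN hr hf'.
have -> : r' * f * s - - r * f' = r * r' * (a * s + b) - r * (r' * b - f') - r' * s * (r * a - f) by ring.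
by do 2?apply: ideal_of_sub; apply: ideal_of_mul.
Qed.

(** Up to nonzerodivisors every class has a representative fixed by [h]. Such representatives form a
    subring of the domain [S] that meets the ideal only in 0, so if a product of two of them lies in
    the ideal, one factor is 0. *)
Lemma prime_by_elimination : (forall s, eliminable s) ->
  (forall p, h p = p -> I p -> p = 0) -> forall p q, I (p * q) -> I p \/ I q.
Proof.
move=> el fr p q Ipq; have [r [f [hr nr hf E]]] := el p.
have [r' [f' [hr' nr' hf' E']]] := el q.
have : f * f' = 0.
  apply: fr; first by rewrite rmorphM hf hf'.
  have -> : f * f' = r * r' * (p * q) - r' * q * (r * p - f) - f * (r' * q - f') by ring.
  by do 2?apply: ideal_of_sub; apply: ideal_of_mul.
move/eqP; rewrite mulf_eq0 => /orP[/eqP E0|/eqP E0]; [left; apply: nr|right; apply: nr'].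
  by rewrite E0 subr0 in E.
by rewrite E0 subr0 in E'.
Qed.

Variable x : nat -> nat -> S.

Lemma eliminable_minor rows cols : size cols = size rows ->
  (forall i a, i \in rows -> a \in cols -> eliminable (x i a)) -> eliminable (minor x rows cols).
Proof.
move=> sc H; rewrite /minor /determinant.
apply: (big_ind eliminable); [by apply: eliminable_fixed; rewrite rmorph0|exact: eliminableD|].
move=> s _; apply: eliminableM; first exact: eliminableN1.
apply: (big_ind eliminable); [by apply: eliminable_fixed; rewrite rmorph1|exact: eliminableM|].
by move=> i _; rewrite mxE; apply: H; rewrite mem_nth ?sc.
Qed.

Lemma eliminable_by_minor rows base i a :
  size rows = (size base).+1 -> i \in rows ->
  nonzerodivisor_mod (minor x (delete (index i rows) rows) base) ->
  (forall i' a', i' \in rows -> a' \in base -> eliminable (x i' a')) ->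
  (forall i', i' \in rows -> i' != i -> eliminable (x i' a)) -> uniq rows ->
  I (minor x rows (a :: base)) -> eliminable (x i a).
Proof.
move=> sr ir nzd Hbase Ha ur.
pose p := index i rows; have pr : (p < size rows)%N by rewrite index_mem.
case: rows => [//|i1 rows1] in sr ir nzd Hbase Ha ur p pr *; set rows := i1 :: rows1 in sr ir nzd Hbase Ha ur p pr *.
rewrite {1}/minor (expand_det_col _ ord0) (bigD1 (Ordinal pr)) //=.
have cofE (k : 'I_(size rows1).+1) : cofactor (\matrix_(i0 < (size rows1).+1, j < (size rows1).+1)
     x (nth 0%N rows i0) (nth 0%N (a :: base) j)) k ord0 = (-1) ^+ k * minor x (delete k rows) base.
  rewrite /cofactor addn0; congr (_ * _).
  have sE : (size rows).-1 = size (delete k rows) by rewrite size_delete.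
  rewrite /minor; move: sE; rewrite /= => sE.
  rewrite -[in RHS]sE; congr (\det _); apply/matrixP=> i0 j; rewrite !mxE nth_mkseq //.
rewrite mxE /= !cofE /= nth_index // => Is.
apply: (eliminable_solve (a := (-1) ^+ p * minor x (delete p rows) base)); last by rewrite mulrC; exact: Is.
- apply: eliminableM; first exact: eliminableN1.
  apply: eliminable_minor; first by rewrite size_delete sr.
  by move=> i' a' /mem_delete i'r a'b; apply: Hbase.
- move=> q; rewrite -mulrA => Iq; apply: nzd; rewrite -[_ * q]mul1r -(sqrr_sign _ p) expr2 -mulrA.
  exact: ideal_of_mul.
- apply: (big_ind eliminable); [by apply: eliminable_fixed; rewrite rmorph0|exact: eliminableD|].
  move=> k kp; rewrite mxE cofE; apply: eliminableM.
    have kr : (k < size rows)%N by [].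
    apply: Ha; first exact: mem_nth.
    apply: contraNneq kp => E; rewrite -(inj_eq val_inj) /= -/p /p -E index_uniq //.
  apply: eliminableM; first exact: eliminableN1.
  apply: eliminable_minor; first by rewrite size_delete sr.
  by move=> i' a' /mem_delete i'r a'b; apply: Hbase.
Qed.

End Elimination.

(** * The cycle of cliques *)

Lemma minors_in_mono (R : comNzRingType) (x : nat -> nat -> R) (bs bs' : seq block) p :
  (forall b, b \in bs -> exists2 b' : block, b' \in bs' & b.1 = b'.1 /\ {subset b.2 <= b'.2}) ->
  ideal_of (minors_in x bs) p -> ideal_of (minors_in x bs') p.
Proof.
move=> H; apply: ideal_of_mono => g [b /H [b' b'bs [E sub]] [c [sc csub ->]]].
apply: ideal_of_gen; exists b' => //; exists c; rewrite -E; split=> // a /csub; exact: sub.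
Qed.

Lemma minor_swap_rows (R : comNzRingType) (x : nat -> nat -> R) i j rows c :
  minor x (i :: j :: rows) c = - minor x (j :: i :: rows) c.
Proof.
pose s : 'S_(size rows).+2 := tperm ord0 (lift ord0 ord0).
pose A := \matrix_(k < (size rows).+2, l < (size rows).+2) x (nth 0%N (j :: i :: rows) k) (nth 0%N c l).
have -> : minor x (i :: j :: rows) c = \det (row_perm s A).
  congr (\det _); apply/matrixP=> k l; rewrite !mxE /s.
  case: tpermP => [->|->|] //= k0 k1.
  by case: k k0 k1 => -[|[|k]] // lt H1 H2; [case: H1|case: H2]; apply: val_inj.
by rewrite row_permE det_mulmx det_perm odd_tperm /= expr1 mulN1r.
Qed.

Lemma minor1 (R : comNzRingType) (x : nat -> nat -> R) i a : minor x [:: i] [:: a] = x i a.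
Proof. by rewrite /minor det_mx11 mxE. Qed.

Lemma index_iota s l i : i \in iota s l -> index i (iota s l) = (i - s)%N.
Proof.
rewrite mem_iota => /andP [si il]; have lt : (i - s < l)%N by lia.
by rewrite -{1}(subnKC si) -(nth_iota 0 s lt) index_uniq ?size_iota ?iota_uniq.
Qed.

Lemma index_rev (D : seq nat) a : uniq D -> a \in D -> index a (rev D) = (size D - (index a D).+1)%N.
Proof.
move=> uD aD; have lt : (index a D < size D)%N by rewrite index_mem.
have lt' : (size D - (index a D).+1 < size D)%N by lia.
rewrite -{1}(nth_index 0%N aD).
have -> : nth 0%N D (index a D) = nth 0%N (rev D) (size D - (index a D).+1).
  by rewrite nth_rev //; congr nth; lia.
by rewrite index_uniq ?rev_uniq ?size_rev.
Qed.

Lemma lead_var_iota s l D i a : lead_var (iota s l, D) i a =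
  [&& (s <= i < s + l)%N, a \in D, (i - s <= index a D)%N & (index a D + l <= (i - s) + size D)%N].
Proof.
rewrite /lead_var /= size_iota; case H: (i \in iota s l); last by rewrite mem_iota in H; rewrite H.
by rewrite index_iota // -mem_iota H.
Qed.

Lemma label_lt n k k' a a' : (k < k')%N -> (a < n)%N -> (k * n + a < k' * n + a')%N.
Proof.
move=> kk an; apply: (@leq_trans (k.+1 * n)); first by rewrite mulSn; lia.
by apply: leq_trans (leq_addr _ _); rewrite leq_mul2r kk orbT.
Qed.

Lemma label_inj n k k' a a' : (a < n)%N -> (a' < n)%N -> (k * n + a = k' * n + a')%N -> a = a'.
Proof. by move=> an an' /(congr1 (modn^~ n)); rewrite !modnMDl !modn_small. Qed.

Lemma delete_iota0 s l : delete 0 (iota s l.+1) = iota s.+1 l.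
Proof.
apply: (@eq_from_nth _ 0%N); rewrite size_delete !size_iota // => k kl.
by rewrite nth_mkseq ?size_iota.
Qed.

Lemma delete_iota_last s l : delete l (iota s l.+1) = iota s l.
Proof.
apply: (@eq_from_nth _ 0%N); rewrite size_delete !size_iota // => k kl.
rewrite nth_mkseq ?size_iota // /bump leqNgt.
have -> : (k < l)%N by [].
by rewrite add0n !nth_iota //; lia.
Qed.

Section Cycle.
Variables (K : fieldType) (m n : nat) (S : idomainType).
Variables (C : {rmorphism K -> S}) (x : nat -> nat -> S).
Hypothesis Spoly : polynomial_ring m n C x.

(* The cliques are C_0, ..., C_(r-1); [v j] is the common vertex of C_j and C_(j+1),
   and [int j] lists the vertices of C_j that lie in no other clique; [tag] records
   the position of a column on the cycle. *)
Variables (r : nat) (v : nat -> nat) (int : nat -> seq nat) (tag : nat -> nat).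
Hypotheses (r3 : (3 <= r)%N) (m3 : (3 <= m)%N).
Hypothesis v_lt : forall j, (j < r)%N -> (v j < n)%N.
Hypothesis int_lt : forall (j a : nat), (j < r)%N -> a \in int j -> (a < n)%N.
Hypothesis tag_le : forall a, (tag a <= 2 * r)%N.
Hypothesis tag_v : forall j, (j < r)%N -> tag (v j) = (2 * j + 1)%N.
Hypothesis tag_int : forall (j a : nat), (j < r)%N -> a \in int j -> tag a = (2 * j)%N.
Hypothesis int_sorted : forall j, (j < r)%N -> sorted ltn (int j).
Hypothesis int_size : forall j, (j < r)%N -> (m - 2 <= size (int j))%N.

Let sorted_int (s : nat -> nat) j : (j < r)%N ->
  (forall a b : nat, a \in int j -> b \in int j -> (a < b)%N -> (s a < s b)%N) -> pairwise (relpre s ltn) (int j).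
Proof.
move=> jr Hs; have := int_sorted jr; rewrite sorted_pairwise; last exact: ltn_trans.
move=> pw; apply: (@sub_in_pairwise _ (mem (int j)) ltn) pw => //.
Qed.

(* After pivoting on the column [v 0]: [solved j] is the row in which a column of
   C_j outside [base j] is determined by its other entries and by [base j].
   [sigma2] orders the columns as int 1, v 1, int 2, v 2, ..., v (r-1), int 0,
   and [sigma3] is the reverse order. *)
Let pcols (j : nat) : seq nat :=
  if j == 0%N then v r.-1 :: int 0
  else if j == 1%N then int 1 ++ [:: v 1] else v j.-1 :: int j ++ [:: v j].
Let prows (j : nat) : seq nat := if (j <= 1)%N then iota 1 m.-1 else iota 0 m.
Let solved (j : nat) : nat := if j == 0%N then m.-1 else if j == 1%N then 1%N else 0%N.
Let base (j : nat) : seq nat :=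
  if j == 0%N then drop (size (pcols 0) - (m - 2))%N (pcols 0)
  else take (if j == 1%N then m - 2 else m - 1)%N (pcols j).
Let pkey (a : nat) := if tag a == 0%N then (2 * r)%N else tag a.
Let sigma2 (a : nat) := (pkey a * n + a)%N.
Let sigma3 (a : nat) := ((2 * r).+1 * n - sigma2 a)%N.

(** * Two opposite labellings of the path *)

Let pcols_spec (j a : nat) : (j < r)%N -> a \in pcols j ->
  [\/ a \in int j, (0 < j)%N /\ a = v j, (1 < j)%N /\ a = v j.-1 | j = 0%N /\ a = v r.-1].
Proof.
move=> jr; rewrite /pcols; case: eqP => [->|j0].
  by rewrite inE => /orP[/eqP ->|]; [constructor 4|constructor 1].
case: eqP => [->|j1]; rewrite ?inE mem_cat !inE.
  by case/orP => [|/eqP ->]; [constructor 1|constructor 2].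
case/or3P => [/eqP ->|H|/eqP ->];
  [constructor 3; split=> //; lia|by constructor 1|constructor 2; split=> //; lia].
Qed.

Let pcols_lt (j a : nat) : (j < r)%N -> a \in pcols j -> (a < n)%N.
Proof.
by move=> jr /(pcols_spec jr) [/int_lt-> //|[_ ->]|[_ ->]|[_ ->]]; apply: v_lt; lia.
Qed.

Let sigma2_lt a b : (a < n)%N -> (pkey a < pkey b)%N -> (sigma2 a < sigma2 b)%N.
Proof. by move=> an lt; apply: label_lt. Qed.

Let csorted2 j : (j < r)%N -> csorted sigma2 (pcols j).
Proof.
move=> jr; rewrite /csorted sorted_pairwise; last by move=> ? ? ? /=; apply: ltn_trans.
have pint : pairwise (relpre sigma2 ltn) (int j).
  apply: sorted_int => // a b aj bj ab.
  by rewrite /sigma2 /pkey (tag_int jr aj) (tag_int jr bj) ltn_add2l.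
have kint (a : nat) : a \in int j -> pkey a = if j == 0%N then (2 * r)%N else (2 * j)%N.
  by move=> aj; rewrite /pkey (tag_int jr aj); case: (j) => // k; rewrite mul2n.
have kv k : (k < r)%N -> pkey (v k) = (2 * k + 1)%N.
  by move=> kr; rewrite /pkey tag_v // addn1.
rewrite /pcols; case: eqP => [j0|j0].
  subst j; rewrite /= pint andbT; apply/allP => a aj; apply: sigma2_lt; first by apply: v_lt; lia.
  by rewrite kv ?kint //=; lia.
have last_ok : allrel (relpre sigma2 ltn) (int j) [:: v j].
  rewrite allrel1r; apply/allP => a aj; apply: sigma2_lt; first exact: int_lt aj.
  by rewrite kv // kint //; case: eqP => // _; lia.
case: eqP => [j1|j1]; first by rewrite -j1 pairwise_cat last_ok pint.
rewrite pairwise_cons pairwise_cat last_ok pint /= andbT all_cat /= andbT; apply/andP; split.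
  apply/allP => a aj; apply: sigma2_lt; first by apply: v_lt; lia.
  by rewrite kv ?kint //; [case: (j =P 0%N); lia|lia].
by apply: sigma2_lt; [apply: v_lt; lia|rewrite !kv //; lia].
Qed.

Let pcols_uniq j : (j < r)%N -> uniq (pcols j).
Proof.
move/csorted2; apply: sorted_uniq; first by move=> ? ? ? /=; apply: ltn_trans.
by move=> a; rewrite /= ltnn.
Qed.

Let sigma2_bound a : (a < n)%N -> (sigma2 a < (2 * r).+1 * n)%N.
Proof.
move=> an; rewrite -[X in (_ < X)%N]addn0; apply: label_lt => //.
by rewrite ltnS /pkey; case: eqP.
Qed.

Let csorted3 j : (j < r)%N -> csorted sigma3 (rev (pcols j)).
Proof.
move=> jr; rewrite /csorted rev_sorted; have := csorted2 jr; rewrite /csorted.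
apply: (@sub_in_sorted _ (mem (pcols j))) => [a b aj bj /= lt|]; last by apply/allP.
have := sigma2_bound (pcols_lt jr aj); have := sigma2_bound (pcols_lt jr bj).
by rewrite /sigma3; lia.
Qed.

Let prows_lt (j i : nat) : i \in prows j -> (i < m)%N.
Proof. by rewrite /prows; case: ifP => _; rewrite mem_iota; lia. Qed.

Let prows_sorted j : rsorted id (prows j).
Proof. by rewrite /rsorted /prows; case: ifP => _; apply: iota_ltn_sorted. Qed.

Let sigma2_inj a a' : (a < n)%N -> (a' < n)%N -> sigma2 a = sigma2 a' -> a = a'.
Proof. exact: label_inj. Qed.

Let sigma3_inj a a' : (a < n)%N -> (a' < n)%N -> sigma3 a = sigma3 a' -> a = a'.
Proof.
move=> an an' E; apply: sigma2_inj => //.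
by have := sigma2_bound an; have := sigma2_bound an'; rewrite /sigma3 in E; lia.
Qed.

Let pblock j : block := (prows j, pcols j).
Let pblock3 j : block := (prows j, rev (pcols j)).
Let pblocks := map pblock (iota 0 r).
Let pblocks3 := map pblock3 (iota 0 r).

Let index_last j : (0 < j < r)%N -> index (v j) (pcols j) = (size (pcols j)).-1.
Proof.
move=> /andP[j0 jr]; have := pcols_uniq jr; rewrite /pcols gtn_eqF //.
case: eqP => [->|_].
  by rewrite cats1 rcons_uniq => /andP[/negbTE H _]; rewrite -cats1 index_cat H /= eqxx size_cat /=; lia.
rewrite -cat_cons cats1 rcons_uniq => /andP[/negbTE H _].
by rewrite -cats1 index_cat H /= eqxx !size_cat /=; lia.
Qed.

Let index_first j : (j < r)%N -> j != 1%N ->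
  index (if j == 0%N then v r.-1 else v j.-1) (pcols j) = 0%N.
Proof. by move=> jr j1; rewrite /pcols; case: (j =P 0%N) => _; rewrite ?(negbTE j1) /= eqxx. Qed.

Let lead_var_pblock (j i a : nat) : lead_var (pblock j) i a =
  [&& i \in prows j, a \in pcols j, (i - (j <= 1) <= index a (pcols j))%N &
   (index a (pcols j) + (m - (j <= 1)) <= (i - (j <= 1)) + size (pcols j))%N].
Proof.
rewrite /pblock /prows; by case: ifP => _; rewrite lead_var_iota mem_iota -?subn1 ?subn0.
Qed.

Let lead_var_pblock3 (j i a : nat) : (j < r)%N -> lead_var (pblock3 j) i a =
  [&& i \in prows j, a \in pcols j, (i - (j <= 1) <= size (pcols j) - (index a (pcols j)).+1)%N &
   (size (pcols j) - (index a (pcols j)).+1 + (m - (j <= 1)) <= (i - (j <= 1)) + size (pcols j))%N].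
Proof.
move=> jr; rewrite /pblock3 /prows; case: ifP => _; rewrite lead_var_iota mem_iota mem_rev size_rev.
  by case: (boolP (a \in pcols j)) => aj; rewrite ?andbF // (index_rev (pcols_uniq jr) aj) -?subn1.
by case: (boolP (a \in pcols j)) => aj; rewrite ?andbF // (index_rev (pcols_uniq jr) aj) !subn0.
Qed.

Let pcols_tag (j a : nat) : (j < r)%N -> a \in pcols j ->
  [\/ tag a = (2 * j)%N, [/\ (0 < j)%N, a = v j & tag a = (2 * j + 1)%N] |
      [/\ j != 1%N, a = (if j == 0%N then v r.-1 else v j.-1) &
          tag a = (if j == 0%N then 2 * r - 1 else 2 * j - 1)%N]].
Proof.
move=> jr /(pcols_spec jr) [/(tag_int jr) ->|[j0 ->]|[j1 ->]|[-> ->]].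
- by constructor 1.
- by constructor 2; rewrite tag_v.
- have j0 : (j == 0%N) = false by lia.
  by constructor 3; rewrite j0; split; [lia| |rewrite tag_v; lia].
- by constructor 3; split=> //=; rewrite tag_v; lia.
Qed.

(** The shared column that closes a block is last there and can only use the bottom row; the one
    that opens it is first and can only use the top row, which is row 0 or, in block 0, row 1. As
    [m >= 3], the bottom row [m - 1] is at least 2, so neighbouring blocks share no initial
    variable. *)
Let pblock_lead_row (j i a : nat) : (j < r)%N -> lead_var (pblock j) i a ->
  ((0 < j)%N /\ tag a = (2 * j + 1)%N -> i = m.-1) /\
  (tag a = (if j == 0%N then 2 * r - 1 else 2 * j - 1)%N -> (i <= 1)%N).
Proof.
move=> jr; rewrite lead_var_pblock => /and4P[ir aj H1 H2].
have im := prows_lt ir; have sz : (0 < size (pcols j))%N by case: (pcols j) aj.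
have lj : ((j <= 1) <= 1)%N := leq_b1 _.
have [E|[j0 E E']|[j1 E E']] := pcols_tag jr aj; split=> //.
- by move=> [_]; lia.
- by case: (j =P 0%N) => ?; lia.
- move=> _; rewrite E index_last ?j0 // in H2; lia.
- by case: (j =P 0%N) => ?; lia.
- by move=> [j0]; rewrite E'; case: (j =P 0%N) => ?; lia.
- by move=> _; rewrite E index_first // in H1; lia.
Qed.

(** Reversing the columns exchanges the two extremal rows. *)
Let pblock3_lead_row (j i a : nat) : (j < r)%N -> lead_var (pblock3 j) i a ->
  ((0 < j)%N /\ tag a = (2 * j + 1)%N -> (i <= 1)%N) /\
  (tag a = (if j == 0%N then 2 * r - 1 else 2 * j - 1)%N -> i = m.-1).
Proof.
move=> jr; rewrite lead_var_pblock3 // => /and4P[ir aj H1 H2].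
have im := prows_lt ir; have sz : (0 < size (pcols j))%N by case: (pcols j) aj.
have lj : ((j <= 1) <= 1)%N := leq_b1 _.
have [E|[j0 E E']|[j1 E E']] := pcols_tag jr aj; split=> //.
- by move=> [_]; lia.
- by case: (j =P 0%N) => ?; lia.
- by move=> _; rewrite E index_last ?j0 // in H1; lia.
- by case: (j =P 0%N) => ?; lia.
- by move=> [j0]; rewrite E'; case: (j =P 0%N) => ?; lia.
- move=> _; rewrite E index_first // in H2; lia.
Qed.

(** Interior columns have even tags, which determine the block, so a column in two blocks closes one
    of them and opens the other. *)
Let tags_meet (j j' a : nat) : (j < j')%N -> (j' < r)%N -> a \in pcols j -> a \in pcols j' ->
  ((0 < j)%N /\ tag a = (2 * j + 1)%N /\ tag a = (if j' == 0%N then 2 * r - 1 else 2 * j' - 1)%N) \/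
  ((0 < j')%N /\ tag a = (2 * j' + 1)%N /\ tag a = (if j == 0%N then 2 * r - 1 else 2 * j - 1)%N).
Proof.
move=> jj j'r; have jr := ltn_trans jj j'r.
have -> : (j' == 0%N) = false by lia.
move=> /(pcols_tag jr) [E|[j0 _ E]|[j1 _ E]] /(pcols_tag j'r) [E'|[j'0 _ E']|[j'1 _ E']];
  move: E E'; rewrite ?(gtn_eqF (leq_ltn_trans (leq0n j) jj)); try case: (j =P 0%N); lia.
Qed.

Let pcols_inj j j' : (j < r)%N -> (j' < r)%N -> pcols j = pcols j' -> j = j'.
Proof.
move=> jr j'r E; have : (0 < size (int j))%N by have := int_size jr; lia.
case H: (int j) => [//|a s] _; have aj : a \in int j by rewrite H mem_head.
have aP : a \in pcols j.
  rewrite /pcols; case: (j =P 0%N) => [j0|_]; first by subst j; rewrite inE aj orbT.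
  case: (j =P 1%N) => [j1|_]; first by subst j; rewrite mem_cat aj.
  by rewrite inE mem_cat aj orbT.
rewrite E in aP; have := pcols_tag j'r aP; rewrite (tag_int jr aj).
by case=> [|[]|[]]; try case: (j' =P 0%N); lia.
Qed.

Let pblocks_disjoint (bl : nat -> block) :
  (forall j i a, (j < r)%N -> lead_var (bl j) i a -> a \in pcols j) ->
  (forall j j' (i a : nat), (j < r)%N -> (j' < r)%N -> lead_var (bl j) i a -> lead_var (bl j') i a ->
    (0 < j)%N -> tag a = (2 * j + 1)%N ->
    tag a = (if j' == 0%N then 2 * r - 1 else 2 * j' - 1)%N -> False) ->
  forall b b' i a, b \in map bl (iota 0 r) -> b' \in map bl (iota 0 r) ->
    lead_var b i a -> lead_var b' i a -> b = b'.
Proof.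
move=> Hmem Hrow b b' i a /mapP [j]; rewrite mem_iota /= => jr -> /mapP [j']; rewrite mem_iota /= => j'r ->.
move=> l l'; have a1 := Hmem _ _ _ jr l; have a2 := Hmem _ _ _ j'r l'.
case: (ltngtP j j') => [lt|lt|-> //]; exfalso.
  by case: (tags_meet lt j'r a1 a2) => -[? [? ?]]; [apply: (Hrow j j')|apply: (Hrow j' j)]; eassumption.
by case: (tags_meet lt jr a2 a1) => -[? [? ?]]; [apply: (Hrow j' j)|apply: (Hrow j j')]; eassumption.
Qed.

Let lead_mem2 (j i a : nat) : (j < r)%N -> lead_var (pblock j) i a -> a \in pcols j.
Proof. by move=> _; rewrite lead_var_pblock => /and4P[]. Qed.

Let lead_mem3 (j i a : nat) : (j < r)%N -> lead_var (pblock3 j) i a -> a \in pcols j.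
Proof. by move=> jr; rewrite lead_var_pblock3 // => /and4P[]. Qed.

Let disjoint2 : forall b b' i a, b \in pblocks -> b' \in pblocks ->
    lead_var b i a -> lead_var b' i a -> b = b'.
Proof.
apply: pblocks_disjoint => [j i a|j j' i a jr j'r l l' j0 t t']; first exact: lead_mem2.
have [H _] := pblock_lead_row jr l; have [_ H'] := pblock_lead_row j'r l'.
by have := H (conj j0 t); have := H' t'; lia.
Qed.

Let disjoint3 : forall b b' i a, b \in pblocks3 -> b' \in pblocks3 ->
    lead_var b i a -> lead_var b' i a -> b = b'.
Proof.
apply: pblocks_disjoint => [j i a|j j' i a jr j'r l l' j0 t t']; first exact: lead_mem3.
have [H _] := pblock3_lead_row jr l; have [_ H'] := pblock3_lead_row j'r l'.
by have := H (conj j0 t); have := H' t'; lia.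
Qed.

Let pblocks_uniq : uniq pblocks.
Proof.
rewrite map_inj_in_uniq ?iota_uniq // => j j'; rewrite !mem_iota /= => jr j'r [_].
exact: pcols_inj.
Qed.

Let pblocks3_uniq : uniq pblocks3.
Proof.
rewrite map_inj_in_uniq ?iota_uniq // => j j'; rewrite !mem_iota /= => jr j'r [_ /(can_inj revK)].
exact: pcols_inj.
Qed.

Let adapted2 : all (adapted m n sigma2 id) pblocks.
Proof.
apply/allP => b /mapP [j]; rewrite mem_iota /= => jr ->; apply/and4P; split.
- exact: prows_sorted.
- exact: csorted2.
- by apply/allP => i; apply: prows_lt.
- by apply/allP => a; apply: pcols_lt.
Qed.

Let adapted3 : all (adapted m n sigma3 id) pblocks3.
Proof.
apply/allP => b /mapP [j]; rewrite mem_iota /= => jr ->; apply/and4P; split.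
- exact: prows_sorted.
- exact: csorted3.
- by apply/allP => i; apply: prows_lt.
- by apply/allP => a; rewrite mem_rev; apply: pcols_lt.
Qed.

Let size_pcols j : size (pcols j) = (size (int j) + (if (j <= 1)%N then 1 else 2))%N.
Proof.
rewrite /pcols; case: (j =P 0%N) => [->|j0]; first by rewrite /= addn1.
case: (j =P 1%N) => [->|j1]; first by rewrite size_cat.
have -> : (j <= 1)%N = false by lia.
by rewrite /= size_cat /=; lia.
Qed.

(** * Solving for variables along the path *)

Let offset (j : nat) := (if j == 0%N then size (pcols 0) - (m - 2) else 0)%N.

(** One column less than the block has rows, so that any further column completes a square minor.
    Blocks 0 and 1 have only [m - 1] rows, as row 0 was spent on the pivot; from [j = 2] on,
    [v j.-1] joins [m - 2] interior columns. *)
Let size_base j : (j < r)%N -> size (base j) = (if (j <= 1)%N then m - 2 else m - 1)%N.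
Proof.
move=> jr; have H := int_size jr; have E := size_pcols j; rewrite /base.
case: (j =P 0%N) => [j0|j0].
  subst j; have {}E : size (pcols 0) = (size (int 0) + 1)%N := E.
  by rewrite [LHS]size_drop -[RHS]/(m - 2)%N; lia.
case: (j =P 1%N) => [j1|j1].
  subst j; have {}E : size (pcols 1) = (size (int 1) + 1)%N := E.
  have H' : (m - 2 <= size (pcols 1))%N by lia.
  exact: (size_takel H').
have j2 : (j <= 1)%N = false by lia.
rewrite j2 in E *; have H' : (m - 1 <= size (pcols j))%N by lia.
exact: (size_takel H').
Qed.

Let nth_base j l : (j < r)%N -> (l < size (base j))%N ->
  nth 0%N (base j) l = nth 0%N (pcols j) (offset j + l).
Proof.
move=> jr; rewrite size_base // /base /offset.
case: (j =P 0%N) => [j0|j0]; first by subst j; rewrite [LHS]nth_drop.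
case: (j =P 1%N) => [j1|j1] lt; first by subst j; rewrite [LHS]nth_take.
by rewrite [LHS]nth_take //; move: lt; have -> : (j <= 1)%N = false by lia.
Qed.

Let shape j : (j < r)%N -> (m - 2 <= size (int j))%N /\
  [\/ [/\ j = 0%N, offset j = (size (pcols j) - (m - 2))%N, size (base j) = (m - 2)%N &
        size (pcols j) = (size (int j) + 1)%N],
      [/\ j = 1%N, offset j = 0%N, size (base j) = (m - 2)%N & size (pcols j) = (size (int j) + 1)%N] |
      [/\ (1 < j)%N, offset j = 0%N, size (base j) = (m - 1)%N & size (pcols j) = (size (int j) + 2)%N]].
Proof.
move=> jr; split; first exact: int_size.
have H := size_base jr; have E := size_pcols j.
have [j0|j0] := eqVneq j 0%N; first by subst j; constructor 1.
have [j1|j1] := eqVneq j 1%N; first by subst j; constructor 2.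
have j2 : (j <= 1)%N = false by lia.
rewrite j2 in H E; constructor 3; split=> //; first lia.
by rewrite /offset (negbTE j0).
Qed.

Let mem_base (j a : nat) : (j < r)%N -> a \in pcols j ->
  (a \in base j) = (offset j <= index a (pcols j) < offset j + size (base j))%N.
Proof.
move=> jr aj; have lt : (index a (pcols j) < size (pcols j))%N by rewrite index_mem.
apply/idP/idP => [/(nthP 0%N) [l lb <-]|/andP[H1 H2]].
  have : (offset j + l < size (pcols j))%N.
    by have {}lb : (l < size (base j))%N := lb; have [] := shape jr => ? [] [? ? ? ?]; lia.
  by move=> ?; rewrite nth_base // index_uniq ?pcols_uniq // leq_addr ltn_add2l.
have lb : (index a (pcols j) - offset j < size (base j))%N by rewrite ltn_subLR.
have := mem_nth 0%N lb; rewrite nth_base // subnKC // nth_index //.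
Qed.

Let sub_base j : {subset base j <= pcols j}.
Proof.
by move=> a; rewrite /base; case: (j =P 0%N) => [->|_]; [apply: mem_drop|apply: mem_take].
Qed.

Let offset_size j : (j < r)%N -> (offset j + size (base j) <= size (pcols j))%N.
Proof.
by move=> jr; have [] := shape jr => ? [] [? ? ? ?]; lia.
Qed.

Let delrows (j : nat) := iota (if j == 1%N then 2 else 1)%N (if (j <= 1)%N then m - 2 else m - 1)%N.

Let solved_in (j : nat) : solved j \in prows j.
Proof.
rewrite /solved /prows; case: (j =P 0%N) => [->|j0] /=; first by rewrite mem_iota; lia.
by case: (j =P 1%N) => [->|j1] /=; [|case: ifP]; rewrite mem_iota; lia.
Qed.

Let index_solved (j : nat) : index (solved j) (prows j) = if j == 0%N then (m - 2)%N else 0%N.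
Proof.
have := solved_in j; rewrite /solved /prows; case: (j =P 0%N) => [->|j0] /= H.
  by rewrite index_iota //; lia.
move: H; case: (j =P 1%N) => [->|j1] /=; first by move=> H; rewrite index_iota.
have -> : (j <= 1)%N = false by lia.
by move=> H; rewrite index_iota.
Qed.

Let delrowsE (j : nat) : delete (index (solved j) (prows j)) (prows j) = delrows j.
Proof.
rewrite index_solved /prows /delrows.
have E1 : m.-1 = (m - 2).+1 by lia.
have E2 : m = (m - 1).+1 by lia.
have [j0|j0] := eqVneq j 0%N; first by subst j; rewrite E1; apply: delete_iota_last.
have [j1|j1] := eqVneq j 1%N; first by subst j; rewrite E1; apply: delete_iota0.
have -> : (j <= 1)%N = false by lia.
by rewrite {1}E2; apply: delete_iota0.
Qed.

Let path_adjacent (j j' a : nat) : (j < j')%N -> (j' < r)%N -> a \in pcols j -> a \in pcols j' ->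
  [/\ (0 < j)%N, tag a = (2 * j + 1)%N & j' = j.+1] \/ [/\ j = 0%N, j' = r.-1 & tag a = (2 * r - 1)%N].
Proof.
move=> jj j'r aj aj'; case: (tags_meet jj j'r aj aj') => -[h1 [h2 h3]].
  left; split=> //; have j'0 : (j' == 0%N) = false by clear -jj; lia.
  by rewrite j'0 in h3; clear -h2 h3 jj; lia.
right; move: h3; case: (j =P 0%N) => [j0 h3|j0 h3]; last by clear -h2 h3 jj j0; lia.
by split=> //; clear -h2 h3 r3; lia.
Qed.

(** There are enough interior columns for [base j] to stop before the column shared with a block
    solved later. For block 0 that column is [v r.-1], the first one, so its base is taken from the
    end. *)
Let base_tag (j a : nat) : (j < r)%N -> a \in base j ->
  ((0 < j)%N -> tag a <> (2 * j + 1)%N) /\ (j = 0%N -> tag a <> (2 * r - 1)%N).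
Proof.
move=> jr aj; have aP := sub_base aj; move: aj; rewrite mem_base // => /andP[H1 H2].
have [? Sh] := shape jr; split=> [j0 ta|j0 ta].
  have E : a = v j.
    case: (pcols_tag jr aP) => [t|[_ E _]|[_ _ t]] //; exfalso; rewrite ta in t; first by lia.
    by move: t; case: (j =P 0%N) => ?; lia.
  have := index_last (j := j); rewrite -E j0 jr => /(_ isT) Hi; rewrite Hi in H1 H2.
  by case: Sh => [[? ? ? ?]|[? ? ? ?]|[? ? ? ?]]; lia.
subst j; have E : a = v r.-1 by case: (pcols_tag jr aP) => [t|[]|[_ E _]] //; lia.
have := index_first jr isT; rewrite eqxx -E => Hi; rewrite Hi in H1.
by case: Sh => [[? ? ? ?]|[? ? ? ?]|[? ? ? ?]]; lia.
Qed.

(** The diagonal of this minor runs just beside the band of initial variables of its block: with the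
    solved row deleted, each base column meets a row one step too low, or in block 0 one step too
    high. *)
Let base_nzd j : (j < r)%N ->
  nonzerodivisor_mod (minors_in x pblocks) (minor x (delrows j) (base j)).
Proof.
move=> jr p; have sb := size_base jr; have ob := offset_size jr.
have sp := size_pcols j; have si := int_size jr.
apply: (minor_nzd Spoly (sigma := sigma2) (tau := id)) => //.
- by rewrite /rsorted; apply: iota_ltn_sorted.
- rewrite /csorted /base; have := csorted2 jr; have := @csorted2 0 (ltac:(lia)).
  by rewrite /csorted; case: (j =P 0%N) => [_ H _|_ _ H]; [apply: drop_sorted|apply: take_sorted].
- by rewrite sb size_iota.
- apply/allP => i; rewrite mem_iota => /andP[_ H]; apply: leq_trans H _.
  by have [->|j1] := eqVneq j 1%N; [rewrite leqnn|case: ifP => _]; lia.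
- by apply/allP => a /sub_base /(pcols_lt jr).
move=> b l /mapP [j']; rewrite mem_iota /= => j'r ->; rewrite size_iota => lt.
have lb : (l < size (base j))%N by rewrite sb.
have lp : (offset j + l < size (pcols j))%N by lia.
rewrite nth_iota // nth_base //; set a := nth 0%N (pcols j) _.
have aj : a \in pcols j by apply: mem_nth.
have ia : index a (pcols j) = (offset j + l)%N by rewrite index_uniq ?pcols_uniq.
apply/negP => H; have aj' := lead_mem2 j'r H.
have [E|ne] := eqVneq j' j.
  subst j'; move: H; rewrite lead_var_pblock ia => /and4P [_ _ H1 H2].
  move: H1 H2; have [? [] [E ? ? ?]] := shape jr.
  - by subst j; rewrite /= ; lia.
  - by subst j; rewrite /= ; lia.
  - have -> : (j == 1%N) = false by lia.
    have -> : (j <= 1)%N = false by lia.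
    by rewrite /=; lia.
have ab : a \in base j by rewrite mem_base // ia leq_addr ltn_add2l.
have [T1 T2] := base_tag jr ab.
case: (ltngtP j' j) ne => // [lt'|lt'] _; last first.
  by case: (path_adjacent lt' j'r aj aj') => -[h1 h2 h3]; [apply: (T1 h1)|apply: (T2 h1)].
case: (path_adjacent lt' jr aj' aj) => -[h1 h2 h3]; last first.
  by apply: T1; [clear -h2 r3; lia|rewrite h3 h2; clear -r3; lia].
(* The shared base column is [v j.-1], the first one, which meets row 1 on this diagonal. The
   previous block uses it only in row [m - 1], which is different as [m >= 3]. *)
have [rE _] := pblock_lead_row j'r H; have {}rE := rE (conj h1 h2).
have E : a = v j'.
  case: (pcols_tag j'r aj') => [t|[_ E _]|[_ _ t]] //; exfalso; rewrite h2 in t; first by clear -t; lia.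
  by move: t; case: (j' =P 0%N) => e; clear -h1 e; lia.
have j1 : j != 1%N by clear -h1 h3; lia.
have j0 : (j == 0%N) = false by clear -h3; lia.
have := index_first jr j1; rewrite j0 h3 /= -E -h3 ia.
move: rE; rewrite (negbTE j1); have j2 : (j <= 1)%N = false by clear -h1 h3; lia.
by clear -m3; lia.
Qed.

Let U (i a : nat) : bool :=
  has (fun j => [&& i == solved j, a \in pcols j & a \notin base j]) (iota 0 r).

Let U_witness (i a : nat) : U i a ->
  exists j : nat, [/\ (j < r)%N, i = solved j, a \in pcols j & a \notin base j].
Proof.
case/hasP => j; rewrite mem_iota /= => jr /and3P[/eqP H1 H2 H3].
by exists j.
Qed.

(** For a block with [s] rows, the top row leads in all columns but the last [s - 1], the bottom row
    in all but the first [s - 1]. In the reversed order the columns left out are, for the solved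
    row, those of [base j]. *)
Let lead_var3_solved (j a : nat) : (j < r)%N -> lead_var (pblock3 j) (solved j) a -> U (solved j) a.
Proof.
move=> jr; rewrite lead_var_pblock3 // => /and4P [_ aj H1 H2].
apply/hasP; exists j; first by rewrite mem_iota.
rewrite eqxx aj /= mem_base //; have lt : (index a (pcols j) < size (pcols j))%N by rewrite index_mem.
move: H1 H2; rewrite /solved; have [? [] [E ? ? ?]] := shape jr.
- by subst j; rewrite /=; lia.
- by subst j; rewrite /=; lia.
have -> : (j == 0%N) = false by lia.
have -> : (j == 1%N) = false by lia.
have -> : (j <= 1)%N = false by lia.
by rewrite /=; lia.
Qed.

Let Ipath := ideal_of (minors_in x pblocks).

Let kill_exists : exists h : {rmorphism S -> S}, (forall c, h (C c) = C c) /\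
  forall i a, (i < m)%N -> (a < n)%N -> h (x i a) = if U i a then 0 else x i a.
Proof. exact: Spoly.1. Qed.

Let size_prows (j : nat) : (j < r)%N -> size (prows j) = (size (base j)).+1.
Proof.
move=> jr; rewrite size_base // /prows; case: ifP => _; rewrite size_iota; lia.
Qed.

(** Blocks are solved in the order 0, 1, ..., [r - 1]. The last one meets block 0 in [v r.-1], whose
    entry in row [m - 1] has by then been solved in block 0, so that only its entry in row 0
    remains. *)
Let solved_eliminable (h : {rmorphism S -> S}) : (forall c, h (C c) = C c) ->
  (forall i a, (i < m)%N -> (a < n)%N -> h (x i a) = if U i a then 0 else x i a) ->
  forall j a : nat, (j < r)%N -> a \in pcols j -> a \notin base j ->
  eliminable (minors_in x pblocks) h (x (solved j) a).
Proof.
move=> hC hx; pose E j := forall a : nat, a \in pcols j -> a \notin base j ->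
  eliminable (minors_in x pblocks) h (x (solved j) a).
have el (i a : nat) : (i < m)%N -> (a < n)%N ->
    (forall j, (j < r)%N -> i = solved j -> a \in pcols j -> a \notin base j -> E j) ->
    eliminable (minors_in x pblocks) h (x i a).
  move=> im an H; case Uia: (U i a); last by apply: eliminable_fixed; rewrite hx // Uia.
  have [j [jr ij aj aB]] := U_witness Uia.
  by rewrite ij; apply: (H j).
suff step j : (j < r)%N -> ((1 < j)%N -> [/\ E 0%N, E 1%N & E j.-1]) -> E j.
  have E0 : E 0%N by apply: step => //; lia.
  have E1 : E 1%N by apply: step => //; lia.
  suff EJ j : (j < r)%N -> E j by move=> j a jr; apply: EJ.
  elim: j => [|j IH] // jr; apply: step => // _.
  by split=> //; apply: IH; apply: ltnW.
move=> jr IH a aj aB; apply: (@eliminable_by_minor _ _ _ _ (prows j) (base j)).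
- exact: size_prows.
- exact: solved_in.
- by rewrite delrowsE; apply: base_nzd.
- move=> i' a' i'r a'b; have a'j := sub_base a'b.
  apply: el; [exact: prows_lt i'r|exact: (pcols_lt jr)|].
  move=> j' j'r Ei a'j' a'B'; have [T1 T2] := base_tag jr a'b.
  (* A base column shared with another block belongs to the preceding one, which is already
     solved. *)
  case: (ltngtP j j') => [lt|lt|Ej]; last by move: a'B'; rewrite -Ej a'b.
    by exfalso; case: (path_adjacent lt j'r a'j a'j') => -[h1 h2 h3]; [apply: (T1 h1)|apply: (T2 h1)].
  case: (path_adjacent lt jr a'j' a'j) => -[h1 h2 h3].
    by subst j; have [] := IH h1.
  by case: T1; [rewrite h2; clear -r3; lia|rewrite h3 h2; clear -r3; lia].
- move=> i' i'r i'j; apply: el; [exact: prows_lt i'r|exact: (pcols_lt jr)|].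
  move=> j' j'r Ei aj' aB'.
  (* For [j >= 2] the solved row is 0, so an entry in another row can only be solved for in block 0
     or 1, and these came first. *)
  have [j1|j1] := leqP j 1; last first.
    have [E0 E1 _] := IH j1.
    case: j' Ei {aB' aj' j'r} => [//|[//|j']] Ei; exfalso.
    move: i'j; rewrite Ei /solved /=; have -> : (j == 0%N) = false by clear -j1; lia.
    by have -> : (j == 1%N) = false by clear -j1; lia.
  (* Blocks 0 and 1 have no row 0, so a conflict could only come from the other one of the two; but
     without [v 0] they have no common column. *)
  exfalso; have jj' : j != j' by apply: contraNneq i'j => ->; rewrite Ei.
  have j'1 : (j' <= 1)%N.
    rewrite leqNgt; apply/negP => j'2; move: i'r; rewrite Ei /solved /prows j1.
    have -> : (j' == 0%N) = false by clear -j'2; lia.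
    have -> : (j' == 1%N) = false by clear -j'2; lia.
    by rewrite mem_iota.
  have [a0 a1] : a \in pcols 0 /\ a \in pcols 1.
    have [[e e']|[e e']] : (j = 0%N /\ j' = 1%N) \/ (j = 1%N /\ j' = 0%N) by clear -jj' j1 j'1; lia.
      by subst j j'.
    by subst j j'.
  by case: (path_adjacent (ltn0Sn 0) (ltac:(clear -r3; lia)) a0 a1) => -[h1 h2 h3] //; clear -r3 h2; lia.
- by rewrite /prows; case: ifP => _; apply: iota_uniq.
- apply: ideal_of_gen; exists (pblock j); first by apply: map_f; rewrite mem_iota.
  exists (a :: base j); split=> //; first by rewrite size_prows.
  by move=> a'; rewrite inE => /orP[/eqP -> //|/sub_base].
Qed.

Let path_prime p q : Ipath (p * q) -> Ipath p \/ Ipath q.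
Proof.
have [h [hC hx]] := kill_exists; apply: (prime_by_elimination (h := h)).
  apply: Spoly.2 => [c|i a im an||].
  - by apply: eliminable_fixed; rewrite hC.
  - case Uia: (U i a); last by apply: eliminable_fixed; rewrite hx // Uia.
    by have [j [jr -> aj aB]] := U_witness Uia; apply: solved_eliminable.
  - exact: eliminableD.
  - exact: eliminableM.
move=> s hs Is; apply: (@no_relation_among_free _ _ _ _ _ _ Spoly sigma3 id pblocks3 _ _ _ _ _ _ U h) => //.
- move=> b /mapP [j]; rewrite mem_iota /= => jr ->; exists (solved j); first exact: solved_in.
  by move=> a; apply: lead_var3_solved.
(* Minors may list their columns in any order, so the reversed blocks generate the same ideal. *)
apply: minors_in_mono Is => b /mapP [j jr ->]; exists (pblock3 j); first exact: map_f.
by split=> // a; rewrite mem_rev.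
Qed.

Let v_notin_path (j : nat) : (j < r)%N -> v 0 \notin pcols j.
Proof.
move=> jr; apply/negP => /(pcols_tag jr); rewrite tag_v; last by lia.
by case=> [|[]|[]]; try case: (j =P 0%N); lia.
Qed.

(** After the pivot, the column [v 0] occurs in no block. *)
Let path_nzd p : Ipath (x 0 (v 0) * p) -> Ipath p.
Proof.
rewrite -(minor1 x) => H; apply: (minor_nzd Spoly (sigma := sigma2) (tau := id)) H => //.
- by rewrite /= andbT; lia.
- by rewrite /= andbT v_lt //; lia.
move=> b [|//] /mapP [j]; rewrite mem_iota /= => jr -> _; apply/negP => /(lead_mem2 jr).
by rewrite (negbTE (v_notin_path jr)).
Qed.

(* [sigma1] orders the columns of the cycle as int 0, v (r-1), v 0, int 1, v 1, ...,
   v (r-2), int (r-1).  In the column [v 0] the initial monomials use only the first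
   and the last row in the order [erows], so its entry in row 0 is unused. *)
Let ecols (j : nat) : seq nat :=
  if j == 0%N then int 0 ++ [:: v r.-1; v 0]
  else if j == r.-1 then v r.-1 :: v r.-2 :: int r.-1
  else v j.-1 :: int j ++ [:: v j].
Let swap01 (i : nat) : nat := if i == 0%N then 1%N else if i == 1%N then 0%N else i.
Let erows : seq nat := 1%N :: 0%N :: iota 2 (m - 2).
Let ekey (a : nat) : nat :=
  if tag a == 0%N then 0%N else if tag a == (2 * r - 1)%N then 1%N else (tag a).+1.
Let sigma1 (a : nat) : nat := (ekey a * n + a)%N.
Let eblock (j : nat) : block := (erows, ecols j).
Let eblocks := map eblock (iota 0 r).
Let before (j : nat) : nat := if j == 0%N then r.-1 else j.-1.

(** * The labelling of the cycle that frees the pivot entry *)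

Let before_lt (j : nat) : (j < r)%N -> (before j < r)%N.
Proof. by rewrite /before; case: (j =P 0%N) => e; clear -r3 e; lia. Qed.

Let ecols_mem (j a : nat) : (j < r)%N ->
  (a \in ecols j) = [|| a \in int j, a == v j | a == v (before j)].
Proof.
move=> jr; rewrite /ecols /before.
case: (j =P 0%N) => [->|j0]; first by rewrite mem_cat !inE (orbC (a == v 0)).
case: (j =P r.-1) => [jE|j1]; last by rewrite inE mem_cat inE orbC -orbA.
rewrite !inE jE; case: (a == v r.-1); case: (a == v r.-2); rewrite ?orbT //= ?orbF //.
Qed.

Let v_notin_int (j k : nat) : (j < r)%N -> (k < r)%N -> v j \notin int k.
Proof.
by move=> jr kr; apply/negP => /(tag_int kr); rewrite tag_v //; clear; lia.
Qed.

Let v_inj (j k : nat) : (j < r)%N -> (k < r)%N -> (v j == v k) = (j == k).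
Proof.
move=> jr kr; apply/eqP/eqP => [E|-> //].
by have := tag_v jr; rewrite E tag_v //; clear; lia.
Qed.

Let v_eq (j k : nat) : (j < r)%N -> (k < r)%N -> v j = v k -> j = k.
Proof. by move=> jr kr E; apply/eqP; rewrite -v_inj // E. Qed.

Let ekey_int (j a : nat) : (j < r)%N -> a \in int j -> ekey a = if j == 0%N then 0%N else (2 * j + 1)%N.
Proof.
move=> jr /(tag_int jr); rewrite /ekey => ->; case: (j =P 0%N) => [->//|j0].
have -> : (2 * j == 0)%N = false by clear -j0; lia.
by have -> : (2 * j == 2 * r - 1)%N = false by [clear -r3; lia]; rewrite addn1.
Qed.

Let ekey_v (j : nat) : (j < r)%N -> ekey (v j) = if j == r.-1 then 1%N else (2 * j + 2)%N.
Proof.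
move=> jr; rewrite /ekey tag_v //.
have -> : (2 * j + 1 == 0)%N = false by clear; lia.
case: (j =P r.-1) => [->|j1]; first by have -> : (2 * r.-1 + 1 == 2 * r - 1)%N by [clear -r3; lia].
have -> : (2 * j + 1 == 2 * r - 1)%N = false by clear -j1 jr; lia.
by rewrite addn1 addn2.
Qed.

Let sigma1_lt (a b : nat) : (a < n)%N -> (ekey a < ekey b)%N -> (sigma1 a < sigma1 b)%N.
Proof. by move=> an lt; apply: label_lt. Qed.

Let ecols_lt (j a : nat) : (j < r)%N -> a \in ecols j -> (a < n)%N.
Proof.
move=> jr; rewrite ecols_mem // => /or3P [/int_lt-> //|/eqP ->|/eqP ->]; apply: v_lt => //.
exact: before_lt.
Qed.

Let csorted1 (j : nat) : (j < r)%N -> csorted sigma1 (ecols j).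
Proof.
move=> jr; rewrite /csorted sorted_pairwise; last by move=> ? ? ? /=; apply: ltn_trans.
have pint : pairwise (relpre sigma1 ltn) (int j).
  apply: sorted_int => // a b aj bj ab.
  by rewrite /sigma1 (ekey_int jr aj) (ekey_int jr bj) ltn_add2l.
have int_v k : (k < r)%N -> ((if j == 0%N then 0%N else (2 * j + 1)%N) < ekey (v k))%N ->
    allrel (relpre sigma1 ltn) (int j) [:: v k].
  move=> kr lt; rewrite allrel1r; apply/allP => a aj; apply: sigma1_lt; first exact: int_lt aj.
  by rewrite (ekey_int jr aj).
have v_int k : (k < r)%N -> (ekey (v k) < (if j == 0%N then 0%N else (2 * j + 1)%N))%N ->
    all (relpre sigma1 ltn (v k)) (int j).
  move=> kr lt; apply/allP => a aj; apply: sigma1_lt; first exact: v_lt.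
  by rewrite (ekey_int jr aj).
have v_v k l : (k < r)%N -> (l < r)%N -> (ekey (v k) < ekey (v l))%N -> (sigma1 (v k) < sigma1 (v l))%N.
  by move=> kr lr lt; apply: sigma1_lt => //; apply: v_lt.
have r1 : (r.-1 < r)%N by clear -r3; lia.
have r2 : (r.-2 < r)%N by clear -r3; lia.
have r0 : (0 < r)%N by clear -r3; lia.
have k1 := ekey_v r1; rewrite eqxx in k1.
have k0 := ekey_v r0; rewrite (_ : (0%N == r.-1) = false) in k0; last by clear -r3; lia.
have k2 := ekey_v r2; rewrite (_ : (r.-2 == r.-1) = false) in k2; last by clear -r3; lia.
rewrite /ecols; have [j0|j0] := eqVneq j 0%N.
  subst j; have H1 : allrel (relpre sigma1 ltn) (int 0) [:: v r.-1] by apply: int_v; rewrite // k1.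
  have H0 : allrel (relpre sigma1 ltn) (int 0) [:: v 0] by apply: int_v; rewrite // k0.
  by rewrite pairwise_cat pint allrel_consr -allrel1r H1 H0 /= andbT v_v // k1 k0.
have [j1|j1] := eqVneq j r.-1.
  have H1 : all (relpre sigma1 ltn (v r.-1)) (int j).
    by apply: v_int; rewrite // k1 (negbTE j0); clear -j0; lia.
  have H2 : all (relpre sigma1 ltn (v r.-2)) (int j).
    by apply: v_int; rewrite // k2 (negbTE j0); clear -j1 r3; lia.
  rewrite -{3}j1 !pairwise_cons pint H2 /= H1 v_v // k1 k2; clear -r3; lia.
have bj : (j.-1 < r)%N by clear -jr; lia.
have kj := ekey_v jr; rewrite (negbTE j1) in kj.
have kb := ekey_v bj; rewrite (_ : (j.-1 == r.-1) = false) in kb; last by clear -jr j0; lia.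
have H1 : all (relpre sigma1 ltn (v j.-1)) (int j).
  by apply: v_int; rewrite // kb (negbTE j0); clear -j0; lia.
have H2 : allrel (relpre sigma1 ltn) (int j) [:: v j].
  by apply: int_v; rewrite // kj (negbTE j0); clear -j0; lia.
rewrite pairwise_cons pairwise_cat pint all_cat H1 H2 /= !andbT v_v // kb kj; clear -j0; lia.
Qed.

Let size_erows : size erows = m.
Proof. by rewrite /= size_iota; clear -m3; lia. Qed.

Let mem_erows i : (i \in erows) = (i < m)%N.
Proof.
rewrite !inE mem_iota.
by case: i => [|[|i]] //=; clear -m3; lia.
Qed.

Let index_erows i : (i < m)%N -> index i erows = swap01 i.
Proof.
case: i => [|[|i]] // im; rewrite /erows /swap01 [LHS]/= index_iota; first by rewrite subn2.
by rewrite mem_iota; clear -im m3; lia.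
Qed.

Let swap01_inj i j : swap01 i = swap01 j -> i = j.
Proof. by case: i => [|[|i]]; case: j => [|[|j]]. Qed.

Let swap01_lt i : (i < m)%N -> (swap01 i < m)%N.
Proof. by rewrite /swap01; case: i => [|[|i]] //= H; clear -m3 H; lia. Qed.

Let lead_var_eblock (j i a : nat) : lead_var (eblock j) i a ->
  [/\ (i < m)%N, a \in ecols j, (swap01 i <= index a (ecols j))%N &
      (index a (ecols j) + m <= swap01 i + size (ecols j))%N].
Proof.
rewrite /lead_var -[(eblock j).1]/erows -[(eblock j).2]/(ecols j) size_erows => /and4P [].
by rewrite mem_erows => im aj; rewrite index_erows.
Qed.

(** Here [swap01 i] is the position of row [i] in [erows]. In general the closing column is last and
    uses position [m - 1], the opening one is first and uses position 0. The exceptions are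
    [v r.-1], last but one in block 0 and first in block [r - 1], and [v r.-2], second in block
    [r - 1]. *)
Let eblock_lead_row (j i a : nat) : (j < r)%N -> lead_var (eblock j) i a ->
  (a = v j -> swap01 i = if j == r.-1 then 0%N else m.-1) /\
  (a = v (before j) -> if j == 0%N then (0 < swap01 i)%N
     else if j == r.-1 then (swap01 i <= 1)%N else (swap01 i <= 0)%N).
Proof.
move=> jr /lead_var_eblock [im aj H1 H2]; have im' := swap01_lt im.
have nj k : (k < r)%N -> (v k \in int j) = false by move=> kr; apply/negbTE/v_notin_int.
have r1 : (r.-1 < r)%N by clear -r3; lia.
have r2 : (r.-2 < r)%N by clear -r3; lia.
have r0 : (0 < r)%N by clear -r3; lia.
split=> E; subst a; move: H1 H2; rewrite /ecols /before.
  have [j0|j0] := eqVneq j 0%N.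
    subst j; have -> : (0%N == r.-1) = false by clear -r3; lia.
    rewrite index_cat nj //= v_inj // eqxx size_cat /=.
    have -> : (r.-1 == 0%N) = false by clear -r3; lia.
    by clear -m3 im'; lia.
  have [j1|j1] := eqVneq j r.-1; first by rewrite j1 /= eqxx => H _; clear -H; lia.
  have bj : (j.-1 < r)%N by clear -jr; lia.
  rewrite /= v_inj // (_ : (j.-1 == j) = false); last by clear -j0; lia.
  by rewrite index_cat nj //= eqxx size_cat /=; clear -m3 im'; lia.
have [j0|j0] := eqVneq j 0%N.
  by subst j; rewrite index_cat nj //= eqxx size_cat /=; clear -m3 im'; lia.
have [j1|j1] := eqVneq j r.-1.
  rewrite j1 /= v_inj // (_ : (r.-1 == r.-2) = false); last by clear -r3; lia.
  by rewrite eqxx => H _; clear -H; lia.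
by rewrite /= eqxx => H _; clear -H; lia.
Qed.

Let ecols_inj j j' : (j < r)%N -> (j' < r)%N -> ecols j = ecols j' -> j = j'.
Proof.
move=> jr j'r E; have : (0 < size (int j))%N by have := int_size jr; clear -m3; lia.
case H: (int j) => [//|a s] _; have aj : a \in int j by rewrite H mem_head.
have : a \in ecols j by rewrite ecols_mem // aj.
have br := before_lt j'r.
rewrite E ecols_mem // => /or3P [/(tag_int j'r)|/eqP e|/eqP e].
- by rewrite (tag_int jr aj); clear; lia.
- by have := v_notin_int j'r jr; rewrite -e aj.
- by have := v_notin_int br jr; rewrite -e aj.
Qed.

(** The exceptional columns do no harm as [m >= 3]: [v r.-1] uses positions from [m - 2 > 0] on in
    block 0 against position 0 in block [r - 1], and [v r.-2] uses position [m - 1] in its own block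
    against positions 0 and 1. *)
Let eblocks_disjoint b b' i a : b \in eblocks -> b' \in eblocks ->
  lead_var b i a -> lead_var b' i a -> b = b'.
Proof.
move=> /mapP [j]; rewrite mem_iota /= => jr -> /mapP [j']; rewrite mem_iota /= => j'r ->.
wlog jj : j j' jr j'r / (j < j')%N => [W l l'|l l'].
  by case: (ltngtP j j') => [lt|lt|-> //]; [apply: W|apply/esym/W].
exfalso; have [_ aj _ _] := lead_var_eblock l; have [_ aj' _ _] := lead_var_eblock l'.
have [L1 L2] := eblock_lead_row jr l; have [L1' L2'] := eblock_lead_row j'r l'.
have bj := before_lt jr; have bj' := before_lt j'r.
have j'0 : (j' == 0%N) = false by clear -jj; lia.
have j1 : (j == r.-1) = false by clear -jj j'r; lia.
rewrite j'0 in L2'; rewrite j1 in L1 L2.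
move: aj aj'; rewrite !ecols_mem // => /or3P [aj|/eqP aj|/eqP aj] /or3P [aj'|/eqP aj'|/eqP aj'].
- by have := tag_int jr aj; rewrite (tag_int j'r aj'); clear -jj; lia.
- by have := v_notin_int j'r jr; rewrite -aj' aj.
- by have := v_notin_int bj' jr; rewrite -aj' aj.
- by have := v_notin_int jr j'r; rewrite -aj aj'.
- by have := v_eq jr j'r (etrans (esym aj) aj'); clear -jj; lia.
- have := L1 aj; have := L2' aj'; case: ifP => _; clear -m3; lia.
- by have := v_notin_int bj j'r; rewrite -aj aj'.
- have := L1' aj'; have := L2 aj; have := v_eq bj j'r (etrans (esym aj) aj'); rewrite /before.
  case: (j =P 0%N) => [j0 <-|j0]; last by clear -jj; lia.
  by rewrite eqxx => H0 H1; move: H0; rewrite H1.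
- have := v_eq bj bj' (etrans (esym aj) aj'); rewrite /before j'0.
  by case: (j =P 0%N) => e; clear -e jj j'r; lia.
Qed.

(** In column [v 0], block 0 uses position [m - 1] and block 1 position 0. The swap puts row 0 at
    position 1, which is neither since [m >= 3]. *)
Let ecols_nzd p : ideal_of (minors_in x eblocks) (x 0 (v 0) * p) -> ideal_of (minors_in x eblocks) p.
Proof.
rewrite -(minor1 x) => H; apply: (@minor_nzd _ _ _ _ _ _ Spoly sigma1 swap01 eblocks _ _ _ _ _ _ _ _ _ _ _ _ _ _ _ H) => //.
- by move=> i i' _ _; apply: swap01_inj.
- by move=> a a' an an'; apply: label_inj.
- rewrite map_inj_in_uniq ?iota_uniq // => j j'; rewrite !mem_iota /= => jr j'r [].
  exact: ecols_inj.
- apply/allP => b /mapP [j]; rewrite mem_iota /= => jr ->; apply/and4P; split.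
  + rewrite /rsorted -sorted_map /=; have -> : map swap01 (iota 2 (m - 2)) = iota 2 (m - 2).
      rewrite -[RHS]map_id; apply/eq_in_map => i; rewrite mem_iota => /andP[i2 _].
      by rewrite /swap01; case: i i2 => [|[|i]].
    exact: (iota_ltn_sorted 1 (m - 2).+1).
  + exact: csorted1.
  + by apply/allP => i; rewrite mem_erows.
  + by apply/allP => a; apply: ecols_lt.
- by rewrite /= andbT; clear -m3; lia.
- by rewrite /= andbT v_lt //; clear -r3; lia.
move=> b [|//] /mapP [j]; rewrite mem_iota /= => jr -> _; apply/negP => l.
have r0 : (0 < r)%N by clear -r3; lia.
have [_ vj _ _] := lead_var_eblock l; have [L1 L2] := eblock_lead_row jr l.
move: vj; rewrite ecols_mem // (negbTE (v_notin_int r0 jr)) /= => /orP[/eqP e|/eqP e].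
  have := L1 e; rewrite -(v_eq r0 jr e).
  have -> : (0%N == r.-1) = false by clear -r3; lia.
  by rewrite /swap01 /=; clear -m3; lia.
have := L2 e; have := v_eq r0 (before_lt jr) e; rewrite /before.
case: (j =P 0%N) => [j0|j0]; first by clear -r3; lia.
move=> ej; have j1 : j = 1%N by clear -ej j0; lia.
by rewrite j1; have -> : (1%N == r.-1) = false by clear -r3; lia.
Qed.

Let clique (j : nat) : seq nat := v (before j) :: v j :: int j.

Lemma cycle_prime p q :
  let I := ideal_of (minors_in x (map (fun j => (iota 0 m, v (if j == 0%N then r.-1 else j.-1) :: v j :: int j)) (iota 0 r))) in
  I (p * q) -> I p \/ I q.
Proof.
move=> I; have m0 : (0 < m)%N by clear -m3; lia.
have r0 : (0 < r)%N by clear -r3; lia.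
pose rows := iota 1 m.-1.
have rowsE : iota 0 m = 0%N :: rows by rewrite /rows -{1}(prednK m0).
have blocksE : map (fun j => (iota 0 m, v (if j == 0%N then r.-1 else j.-1) :: v j :: int j)) (iota 0 r)
    = map (full_block rows) (map clique (iota 0 r)).
  by rewrite -map_comp rowsE.
have clique_mem (j a : nat) : (a \in clique j) = [|| a == v (before j), a == v j | a \in int j].
  by rewrite !inE.
rewrite /I blocksE {I blocksE}.
have swapE : iota 0 m = 0%N :: 1%N :: iota 2 (m - 2).
  by have E : m = (m - 2).+2 by [clear -m3; lia]; rewrite {1}E.
(* Interchanging rows 0 and 1 changes only the sign, so the row order of the labelling does not
   affect the ideal. *)
have minorE c : minor x erows c = - minor x (0%N :: rows) c.
  by rewrite -rowsE swapE minor_swap_rows opprK.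
have sizeE : size (0%N :: rows) = size erows by rewrite size_erows -rowsE size_iota.
have to_e s : ideal_of (minors_in x (map (full_block rows) (map clique (iota 0 r)))) s ->
    ideal_of (minors_in x eblocks) s.
  apply: ideal_of_mono => _ [b /mapP [c /mapP [j jr ->] ->] [d [sd sub ->]]].
  rewrite -[minor _ _ _]opprK -minorE; apply/ideal_of_opp/ideal_of_gen.
  exists (eblock j); first exact: map_f.
  exists d; split; [by rewrite sd -sizeE| |by []] => a /sub.
  by rewrite mem_iota in jr; rewrite clique_mem ecols_mem // => /or3P[] ->; rewrite ?orbT.
have of_e s : ideal_of (minors_in x eblocks) s ->
    ideal_of (minors_in x (map (full_block rows) (map clique (iota 0 r)))) s.
  apply: ideal_of_mono => _ [b /mapP [j jr ->] [d [sd sub ->]]].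
  rewrite minorE; apply/ideal_of_opp/ideal_of_gen.
  exists (full_block rows (clique j)); first by do 2!apply: map_f.
  exists d; split; [by rewrite sd sizeE| |by []] => a /sub.
  by rewrite mem_iota in jr; rewrite clique_mem ecols_mem // => /or3P[] ->; rewrite ?orbT.
have v0_clique (j : nat) : (j < r)%N -> (v 0 \in clique j) = (j <= 1)%N.
  move=> jr; rewrite clique_mem (negbTE (v_notin_int r0 jr)) orbF !v_inj ?before_lt // /before.
  by case: (j =P 0%N) => e; clear -e r3; lia.
have path_mem (j a : nat) : (j < r)%N -> (a \in pcols j) = (a \in clique j) && (a != v 0).
  move=> jr; rewrite clique_mem /pcols /before.
  have nv k : (k < r)%N -> v k == v 0 = (k == 0%N) by move=> kr; rewrite v_inj.
  have ni : a \in int j -> a != v 0 by apply: contraTneq => ->; apply: v_notin_int.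
  have [j0|j0] := eqVneq j 0%N.
    subst j; rewrite inE; have [->|_] := eqVneq a (v r.-1).
      by rewrite nv /=; clear -r3; lia.
    by have [->|_] := eqVneq a (v 0); rewrite ?andbF /= ?andbT // (negbTE (v_notin_int r0 r0)).
  have [j1|j1] := eqVneq j 1%N.
    subst j; rewrite mem_cat inE /=; have [->|_] := eqVneq a (v 0).
      by rewrite andbF (negbTE (v_notin_int r0 jr)) v_inj.
    by rewrite andbT orbC.
  rewrite inE mem_cat inE; have [->|_] := eqVneq a (v 0).
    rewrite andbF (negbTE (v_notin_int r0 jr)) !v_inj //; last by clear -jr; lia.
    by clear -j0 j1; lia.
  by rewrite andbT; congr (_ || _); apply: orbC.
have filterE (j a : nat) : (j < r)%N -> (a \in pcols j) = (a \in [seq b <- clique j | b != v 0]).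
  by move=> jr; rewrite mem_filter andbC path_mem.
have to_path s : ideal_of (minors_in x (map (pivot_block (v 0) rows) (map clique (iota 0 r)))) s ->
    Ipath s.
  apply: minors_in_mono => b /mapP [c /mapP [j jr ->] ->]; exists (pblock j); first exact: map_f.
  rewrite mem_iota /= in jr; rewrite /pivot_block v0_clique // /pblock /prows.
  case: ifP => j1; (split; first by rewrite ?rowsE) => a.
    by move=> H; have {}H : a \in [seq b <- clique j | b != v 0] := H; rewrite -filterE in H.
  rewrite path_mem // => ac; rewrite ac; apply: contraTneq ac => ->.
  by rewrite v0_clique // j1.
have of_path s : Ipath s ->
    ideal_of (minors_in x (map (pivot_block (v 0) rows) (map clique (iota 0 r)))) s.
  apply: minors_in_mono => b /mapP [j jr ->]; exists (pivot_block (v 0) rows (clique j)).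
    by do 2!apply: map_f.
  rewrite mem_iota /= in jr; rewrite /pivot_block v0_clique // /pblock /prows.
  case: ifP => j1; (split; first by rewrite ?rowsE) => a H; have {}H : a \in pcols j := H.
    by rewrite filterE in H.
  by move: H; rewrite path_mem // => /andP[].
apply: (pivot_prime Spoly (w := v 0)) => //.
- exact: v_lt.
- by apply/allP => i; rewrite mem_iota /=; clear -m0; lia.
- by rewrite mem_iota.
- move=> c /mapP [j]; rewrite mem_iota /= => jr ->; apply/allP => a; rewrite clique_mem.
  by move=> /or3P [/eqP ->|/eqP ->|/int_lt]; [apply/v_lt/before_lt|apply: v_lt|apply].
- by move=> s Hs; apply/of_e/ecols_nzd/to_e.
- by move=> s Hs; apply/of_path/path_nzd/to_path.
- by move=> s s' /to_path/path_prime [] /of_path; [left|right].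
Qed.

End Cycle.

(** * From the complex to its cliques *)

Lemma minor_iota (R : comNzRingType) (x : nat -> nat -> R) m c :
  minor x (iota 0 m) c = \det (\matrix_(i < m, j < m) x i (nth 0%N c j)).
Proof.
have gen k : size (iota 0 m) = k -> minor x (iota 0 m) c =
    \det (\matrix_(i < k, j < k) x (nth 0%N (iota 0 m) i) (nth 0%N c j)) by move=> <-.
rewrite (gen m) ?size_iota //; congr (\det _); apply/matrixP=> i j.
by rewrite !mxE nth_iota.
Qed.

Lemma minor_not_uniq (R : comNzRingType) (x : nat -> nat -> R) m c :
  size c = m -> ~~ uniq c -> minor x (iota 0 m) c = 0.
Proof.
move=> sc /(uniqPn 0%N) [i [j [ij]]]; rewrite sc => jm E.
have im := ltn_trans ij jm.
rewrite minor_iota -det_tr (@determinant_alternate _ _ _ (Ordinal im) (Ordinal jm)) //.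
  by rewrite -(inj_eq val_inj) /= ltn_eqF.
by move=> k; rewrite !mxE /= E.
Qed.

Lemma minor_perm_cols (R : comNzRingType) (x : nat -> nat -> R) m c d :
  size d = m -> perm_eq c d -> exists e : bool, minor x (iota 0 m) c = (-1) ^+ e * minor x (iota 0 m) d.
Proof.
move=> sd; pose t := Tuple (introT eqP sd); rewrite -[d]/(val t).
case/tuple_permP => p ->; exists (odd_perm p).
pose A := \matrix_(i < m, j < m) x i (nth 0%N t j); rewrite !minor_iota -/A.
have -> : (-1) ^+ p * \det A = \det (col_perm p A).
  by rewrite col_permE det_mulmx det_perm odd_permV mulrC.
congr (\det _); apply/matrixP=> i j; rewrite !mxE.
by rewrite -tnth_nth tnth_mktuple (tnth_nth 0%N).
Qed.

Section IdealGen.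
Variables (R : comNzRingType) (I : finType) (A : {set I}) (g : I -> R).

Lemma in_ideal_gen_gen F : F \in A -> in_ideal_gen R I A g (g F).
Proof.
move=> FA; exists (fun F' => (F' == F)%:R); rewrite (bigD1 F) //= eqxx mul1r big1 ?addr0 //.
by move=> F' /andP[_ /negbTE ->]; rewrite mul0r.
Qed.

Lemma in_ideal_gen_iff p :
  in_ideal_gen R I A g p <-> ideal_of (fun h => exists2 F, F \in A & h = g F) p.
Proof.
split=> [[c ->]|].
  by apply: ideal_of_sum => F FA; apply/ideal_of_mul/ideal_of_gen; exists F.
elim=> [|a h q [F FA ->] _ [c ->]]; first by exists (fun _ => 0); rewrite big1 // => F _; rewrite mul0r.
have [d dE] := in_ideal_gen_gen FA; exists (fun F' => a * d F' + c F').
by rewrite dE mulr_sumr -big_split; apply: eq_bigr => F' _; rewrite mulrDl mulrA.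
Qed.

End IdealGen.

Lemma find_iota_unique (P : pred nat) r j : (j < r)%N ->
  (forall k, (k < r)%N -> P k = (k == j)) -> find P (iota 0 r) = j.
Proof.
move=> jr PE; rewrite (@eq_in_find _ _ (pred1 j)); last first.
  by move=> k; rewrite mem_iota /= => /PE.
by rewrite -/(index j _) index_iota ?subn0 // mem_iota.
Qed.

Section CliqueCycle.
Variables (m n : nat) (Fs : {set {set 'I_n}}) (s : seq {set 'I_n}).
Hypotheses (m3 : (3 <= m)%N) (ci : cond_i m n Fs) (cii : cond_ii m n Fs).
Hypotheses (us : uniq s) (r3 : (3 <= size s)%N).
Hypothesis sE : forall G, (G \in s) = (G \in cliques m n Fs).
Hypothesis adj : forall i j, (i < size s)%N -> (j < size s)%N -> i <> j ->
  (nth set0 s i :&: nth set0 s j != set0) =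
  ((j == (i.+1 %% size s)%N) || (i == (j.+1 %% size s)%N)).

Let r := size s.
Let Cl (j : nat) : {set 'I_n} := nth set0 s j.
Let next (j : nat) : nat := (j.+1 %% r)%N.
Let before (j : nat) : nat := if j == 0%N then r.-1 else j.-1.

Definition common_vertex (j : nat) : nat :=
  if [pick a in Cl j :&: Cl (next j)] is Some a then val a else 0%N.
Let v := common_vertex.

Definition vertices (j : nat) : seq nat := map val (enum (Cl j)).

Definition interior (j : nat) : seq nat :=
  [seq a <- iota 0 n | [&& a \in vertices j, a != v j & a != v (before j)]].

(** A vertex in no clique gets the default value [r] of [find], hence the tag [2 * r]; clique
    vertices have tags up to [2 * r - 1]. *)
Definition vertex_tag (a : nat) : nat :=
  let j := find (fun j => a == v j) (iota 0 r) in
  if (j < r)%N then (2 * j + 1)%N else (2 * find (fun j => a \in vertices j) (iota 0 r))%N.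

Let r_ge3 : (3 <= r)%N. Proof. exact: r3. Qed.

Let nextE j : (j < r)%N -> next j = if j.+1 == r then 0%N else j.+1.
Proof.
rewrite /next => jr; case: eqP => [->|ne]; first by rewrite modnn.
by rewrite modn_small // ltn_neqAle jr andbT; apply/eqP.
Qed.

Let next_lt j : (j < r)%N -> (next j < r)%N.
Proof. by move=> jr; rewrite ltn_mod; clear -jr; lia. Qed.

Let before_lt j : (j < r)%N -> (before j < r)%N.
Proof. by rewrite /before; case: (j =P 0%N) => e; clear -r_ge3 e; lia. Qed.

Let next_before j : (j < r)%N -> next (before j) = j.
Proof.
move=> jr; rewrite nextE ?before_lt // /before; case: (j =P 0%N) => [->|j0].
  by have -> : r.-1.+1 == r by rewrite prednK //; clear -jr; lia.
by rewrite prednK ?lt0n; [rewrite ltn_eqF|apply/eqP].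
Qed.

Let next_neq j : (j < r)%N -> next j != j.
Proof.
move=> jr; rewrite nextE //; case: (j.+1 =P r) => [e|_]; last by rewrite gtn_eqF.
by rewrite eq_sym; clear -r_ge3 e; lia.
Qed.

Let Cl_clique j : (j < r)%N -> Cl j \in cliques m n Fs.
Proof. by move=> jr; rewrite -sE mem_nth. Qed.

Let Cl_neq j k : (j < r)%N -> (k < r)%N -> j != k -> Cl j != Cl k.
Proof. by move=> jr kr ne; rewrite nth_uniq. Qed.

Let mem_vertices (j : nat) (a : nat) :
  reflect (exists2 b : 'I_n, b \in Cl j & a = val b) (a \in vertices j).
Proof.
apply: (iffP mapP) => [[b]|[b bC ->]]; first by rewrite mem_enum => bC ->; exists b.
by exists b; rewrite ?mem_enum.
Qed.

Let common_unique j k (a b : nat) : (j < r)%N -> (k < r)%N -> j != k ->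
  a \in vertices j -> a \in vertices k -> b \in vertices j -> b \in vertices k -> a = b.
Proof.
move=> jr kr ne /mem_vertices [a1 aj ->] /mem_vertices [a2 ak /val_inj E].
move=> /mem_vertices [b1 bj ->] /mem_vertices [b2 bk /val_inj E']; subst a2 b2.
have /card_le1_eqP := ci (Cl_clique jr) (Cl_clique kr) (Cl_neq jr kr ne).
by move/(_ a1 b1) => ->; rewrite // inE ?aj ?ak ?bj ?bk.
Qed.

Let no_triple j k l (a : nat) : (j < r)%N -> (k < r)%N -> (l < r)%N -> j != k -> k != l -> j != l ->
  a \in vertices j -> a \in vertices k -> a \in vertices l -> False.
Proof.
move=> jr kr lr jk kl jl /mem_vertices [a1 aj ->] /mem_vertices [a2 ak /val_inj E].
move=> /mem_vertices [a3 al /val_inj E']; subst a2 a3.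
have := cii (Cl_clique jr) (Cl_clique kr) (Cl_clique lr) (Cl_neq jr kr jk) (Cl_neq kr lr kl) (Cl_neq jr lr jl).
by move/setP/(_ a1); rewrite !inE aj ak al.
Qed.

Let v_mem j : (j < r)%N -> v j \in vertices j /\ v j \in vertices (next j).
Proof.
move=> jr; rewrite /v /common_vertex; case: pickP => [a|none].
  by rewrite inE => /andP[aj an]; split; apply/mem_vertices; exists a.
have := adj jr (next_lt jr) (fun e => negP (next_neq jr) (introT eqP (esym e))).
by rewrite eqxx /= => /set0Pn [a]; have := none a => ->.
Qed.

Let v_mem_before j : (j < r)%N -> v (before j) \in vertices j.
Proof. by move=> jr; have [_] := v_mem (before_lt jr); rewrite next_before. Qed.

(** Cliques that meet are neighbours on the cycle, and condition (i) then leaves only their chosen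
    common vertex. *)
Let meet_vertex j k (a : nat) : (j < r)%N -> (k < r)%N -> j != k ->
  a \in vertices j -> a \in vertices k -> a = v j \/ a = v (before j).
Proof.
move=> jr kr jk aj ak.
have : Cl j :&: Cl k != set0.
  move: aj ak => /mem_vertices [a1 aj ->] /mem_vertices [a2 ak /val_inj E]; subst a2.
  by apply/set0Pn; exists a1; rewrite inE aj.
rewrite adj //; last exact/eqP.
case/orP => /eqP e.
  left; have [H1 H2] := v_mem jr; rewrite -/r -/(next j) in e.
  by apply: (common_unique jr kr jk) => //; rewrite e.
right; have bk : before j = k.
  rewrite -/r -/(next k) in e; rewrite /before e nextE //.
  by case: (k.+1 =P r) => [<-|_].
have [H1 H2] := v_mem kr.
by rewrite bk; apply: (common_unique jr kr jk) => //; rewrite e -/r -/(next k).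
Qed.

(** If two common vertices were equal, the vertex would lie in the cliques [j], [next j], [k] and
    [next k]. At least three of these differ because there are at least three cliques, against
    condition (ii). *)
Let v_inj j k : (j < r)%N -> (k < r)%N -> v j = v k -> j = k.
Proof.
move=> jr kr E; apply/eqP; apply: contraT => jk; exfalso.
have [j1 j2] := v_mem jr; have [k1 k2] := v_mem kr; rewrite -E in k1 k2.
have nj := next_lt jr; have nk := next_lt kr.
have [e|ne] := eqVneq (next j) k; last first.
  by apply: (no_triple jr nj kr _ ne jk j1 j2 k1); rewrite eq_sym next_neq.
apply: (no_triple jr kr nk jk _ _ j1 k1 k2); first by rewrite eq_sym next_neq.
rewrite (nextE kr); rewrite nextE // in e; move: e.
by case: (j.+1 =P r) => f; case: (k.+1 =P r) => g e; clear -r_ge3 f g e; lia.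
Qed.

Let interiorE (j a : nat) : (a \in interior j) = [&& a \in vertices j, a != v j & a != v (before j)].
Proof.
rewrite mem_filter mem_iota /= add0n; case: (boolP (a \in vertices j)) => //= /mem_vertices [b _ ->].
by rewrite ltn_ord andbT.
Qed.

Let vertices_split (j a : nat) : (j < r)%N ->
  (a \in v (before j) :: v j :: interior j) = (a \in vertices j).
Proof.
move=> jr; rewrite !inE interiorE; have [->|_] := eqVneq a (v (before j)).
  by rewrite v_mem_before.
have [->|_] := eqVneq a (v j); last by rewrite /= andbT.
by have [-> _] := v_mem jr; rewrite /= ?orbT.
Qed.

Let vertices_lt (j a : nat) : a \in vertices j -> (a < n)%N.
Proof. by case/mem_vertices => b _ ->; apply: ltn_ord. Qed.

Let tag_le a : (vertex_tag a <= 2 * r)%N.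
Proof.
rewrite /vertex_tag; case: ifP => [H|_]; first by clear -H; lia.
have := find_size (fun j => a \in vertices j) (iota 0 r); rewrite size_iota; clear; lia.
Qed.

Let tag_v j : (j < r)%N -> vertex_tag (v j) = (2 * j + 1)%N.
Proof.
move=> jr; rewrite /vertex_tag (find_iota_unique jr) ?jr // => k kr.
by apply/eqP/eqP => [/v_inj ->|->].
Qed.

Let tag_int (j a : nat) : (j < r)%N -> a \in interior j -> vertex_tag a = (2 * j)%N.
Proof.
move=> jr; rewrite interiorE => /and3P [aj /eqP a1 /eqP a2].
have uj k : (k < r)%N -> a \in vertices k -> k = j.
  move=> kr ak; apply/eqP; apply: contraT => ne; rewrite eq_sym in ne.
  by have [] := meet_vertex jr kr ne aj ak.
rewrite /vertex_tag (@find_iota_unique (fun j => a \in vertices j) r j jr); last first.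
  by move=> k kr; apply/idP/eqP => [/(uj k kr)|-> //].
rewrite ifF //; apply/negbTE; rewrite -leqNgt.
have -> : find (fun j => a == v j) (iota 0 r) = size (iota 0 r); last by rewrite size_iota.
apply: hasNfind; apply/hasPn => k; rewrite mem_iota /= => kr; apply/eqP => E.
have [k1 _] := v_mem kr; rewrite -E in k1.
by have kj := uj k kr k1; rewrite kj in E.
Qed.

Let interior_size j : (j < r)%N -> (m - 2 <= size (interior j))%N.
Proof.
move=> jr; rewrite leq_subLR.
have : (size (vertices j) <= size (v (before j) :: v j :: interior j))%N.
  apply: uniq_leq_size; first by rewrite map_inj_uniq ?enum_uniq //; apply: val_inj.
  by move=> a; rewrite vertices_split.
rewrite /= size_map -cardE; apply: leq_trans.
have := Cl_clique jr; rewrite inE => /andP[/andP[]].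
by [].
Qed.

Lemma clique_cycle_prime (K : fieldType) (S : idomainType) (C : {rmorphism K -> S}) x p q :
  polynomial_ring m n C x ->
  let I := ideal_of (minors_in x (map (fun j => (iota 0 m, vertices j)) (iota 0 r))) in
  I (p * q) -> I p \/ I q.
Proof.
move=> Spoly I.
pose bs := map (fun j => (iota 0 m, v (if j == 0%N then r.-1 else j.-1) :: v j :: interior j)) (iota 0 r).
have to_bs u : I u -> ideal_of (minors_in x bs) u.
  apply: minors_in_mono => b /mapP [j jr ->]; eexists; first by apply: (map_f _ jr).
  by split=> // a /=; rewrite mem_iota in jr; rewrite vertices_split.
have of_bs u : ideal_of (minors_in x bs) u -> I u.
  apply: minors_in_mono => b /mapP [j jr ->]; eexists; first by apply: (map_f _ jr).
  by split=> // a /=; rewrite mem_iota in jr; rewrite vertices_split.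
move=> /to_bs; rewrite /bs => Ipq.
have v_lt j : (j < r)%N -> (v j < n)%N by move=> jr; apply: vertices_lt (v_mem jr).1.
have int_lt (j a : nat) : (j < r)%N -> a \in interior j -> (a < n)%N.
  by move=> jr; rewrite interiorE => /and3P[/vertices_lt].
have int_sorted j : (j < r)%N -> sorted ltn (interior j).
  by move=> jr; apply: sorted_filter (iota_ltn_sorted _ _); apply: ltn_trans.
case: (cycle_prime Spoly r_ge3 m3 v_lt int_lt tag_le tag_v tag_int int_sorted interior_size Ipq).
  by move/of_bs; left.
by move/of_bs; right.
Qed.

End CliqueCycle.

(** The only subset of size [m] of a facet is the facet itself, so it belongs to [in_S] and extends
    to a maximal member. *)
Lemma facet_in_clique m n (Fs : {set {set 'I_n}}) (F : {set 'I_n}) :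
  #|F| = m -> F \in Fs -> exists2 G, G \in cliques m n Fs & F \subset G.
Proof.
move=> cF FFs.
have SF : in_S m n Fs F.
  rewrite /in_S cF leqnn /=; apply/forallP => H; apply/implyP => /andP[HF /eqP cH].
  suff -> : H = F by [].
  by apply/eqP; rewrite eqEcard HF cF cH leqnn.
have [G /maxsetP [SG maxG] FG] := maxset_exists SF; exists G => //.
rewrite inE SG /=; apply/forallP => H; apply/implyP => /andP[SH GH].
by rewrite (maxG H).
Qed.

(** The facets are exactly the [m]-element subsets of the cliques. Column lists in another order add
    nothing to the ideal: a repetition gives 0 and a permutation a sign. *)
Lemma J_Delta_iff (K : fieldType) m n (Fs : {set {set 'I_n}}) s p :
  pure_complex m n Fs -> (forall G, (G \in s) = (G \in cliques m n Fs)) ->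
  J_Delta K m n Fs p <->
  ideal_of (minors_in (xvar K m n) (map (fun j => (iota 0 m, vertices s j)) (iota 0 (size s)))) p.
Proof.
move=> [_ pure] sE; rewrite /J_Delta in_ideal_gen_iff; split.
  apply: ideal_of_mono => _ [F FFs ->]; have cF := pure F FFs.
  have [G GC FG] := facet_in_clique cF FFs; rewrite -sE in GC.
  apply: ideal_of_gen; eexists; first by apply: (map_f _ (_ : index G s \in _)); rewrite mem_iota index_mem.
  exists (map val (enum F)); split => /=.
  - by rewrite size_map size_iota -cardE.
  - move=> a /mapP [b]; rewrite mem_enum => bF ->; rewrite /vertices nth_index //.
    by apply: map_f; rewrite mem_enum (subsetP FG).
  - by rewrite minor_iota.
apply: ideal_of_mono => _ [b /mapP [j jr ->] [c [/= sc sub ->]]].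
rewrite size_iota in sc; rewrite mem_iota /= in jr.
have [uc|nuc] := boolP (uniq c); last by rewrite minor_not_uniq //; apply: ideal_of0.
pose F := [set a : 'I_n | val a \in c].
have cE : perm_eq c (map val (enum F)).
  apply: uniq_perm => //; first by rewrite map_inj_uniq ?enum_uniq //; apply: val_inj.
  move=> a; apply/idP/mapP => [ac|[a1]]; last by rewrite mem_enum inE => a1c ->.
  by have /mapP [a1 _ E] := sub a ac; exists a1 => //; rewrite mem_enum inE -E.
have cF : size (map val (enum F)) = m by rewrite -(perm_size cE).
have FFs : F \in Fs.
  have : nth set0 s j \in cliques m n Fs by rewrite -sE mem_nth.
  rewrite inE => /andP[/andP[_ /forallP/(_ F)/implyP H] _]; apply: H.
  have -> : #|F| = m by rewrite -cF size_map -cardE.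
  rewrite eqxx andbT; apply/subsetP => a; rewrite inE => /sub.
  by move=> /mapP [a1]; rewrite mem_enum => a1C /val_inj ->.
have [e ->] := minor_perm_cols (xvar K m n) cF cE.
apply/ideal_of_mul/ideal_of_gen; exists F => //.
by rewrite minor_iota.
Qed.

Theorem theorem3p3 (K : fieldType) (m n : nat) (Fs : {set {set 'I_n}}) :
  (3 <= m)%N ->
  pure_complex m n Fs ->
  cond_i m n Fs ->
  cond_ii m n Fs ->
  G_is_cycle m n Fs ->
  prime_ideal_pred (Sring K m n) (J_Delta K m n Fs).
Proof.
move=> m3 pure ci cii [s [us r3 sE adj]].
have JE p := @J_Delta_iff K m n Fs s p pure sE.
have Spoly := Sring_polynomial K m n.
split; first by move=> a b /JE Ja /JE Jb; apply/JE/ideal_of_add.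
split; first exact/JE/ideal_of0.
split; first by move=> a b /JE Jb; apply/JE/ideal_of_mul.
split; last first.
  move=> a b /JE /(clique_cycle_prime m3 ci cii us r3 sE adj Spoly) [] H; [left|right]; exact/JE.
(* The ideal is proper: all generators are minors of positive size and vanish when every variable is
   set to 0. *)
move=> /JE J1; have [g [_ gx]] := Spoly.1 K idfun (fun _ _ => 0).
suff : g 1 = 0 by move/eqP; rewrite rmorph1 oner_eq0.
elim: J1 => [|a h q [b /mapP [j _ ->] [c [/= sc sub ->]]] _ IH]; first by rewrite rmorph0.
rewrite rmorphD IH addr0 rmorphM (@minor_morph _ _ g _ (fun _ _ => 0)) //; last first.
  move=> i a0; rewrite mem_iota => /andP[_ im] /sub /mapP [a1 _ ->].
  exact: gx im (ltn_ord a1).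
case: c sc sub => [|a0 c] sc sub; first by rewrite size_iota in sc; rewrite -sc in m3.
by rewrite (@minor_zero_col _ _ _ _ a0) ?mulr0 ?mem_head.
Qed.
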